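(* Let $\Phi$ be a translation-invariant nearest neighbor interaction on a strongly irreducible nearest neighbor $\mathbb{Z}^2$-SFT $X$. Let $t=t_0^{\infty}$ and $b=b_0^{\infty}$ be globally admissible constant rows for $X$ and assume that $n-m$ exceeds the filling distance of $X$. Assume that $q(\Lambda_{\Phi,X})<1$. Then the induced Gibbs state $\mu_{\Phi,X,m,n,t,b}$ for $\Phi$ and $X$, viewed as a measure on bi-infinite sequences of columns of height $n-m+1$, is a one-dimensional translation-invariant mixing 1st-order Markov chain with probability transition matrix $\Pi_{\Phi,X,m,n,t,b}$.
   Context: SFTs: an alphabet is a finite set $\mathcal{A}$ with at least two elements. A nearest neighbor (n.n.) $\mathbb{Z}^2$-SFT is given by $\mathcal{E}_1,\mathcal{E}_2\subseteq\mathcal{A}^2$: $X$ is the set of $x\in\mathcal{A}^{\mathbb{Z}^2}$ with $(x(u),x(u+e_i))\in\mathcal{E}_i$ for all $u\in\mathbb{Z}^2$, $i=1,2$ ($e_1=(1,0),e_2=(0,1)$); $X$ is assumed nonempty. $\mathcal{L}_S(X)=\{x|_S:x\in X\}$; $\mathcal{L}(X)=\bigcup_{S\text{ finite}}\mathcal{L}_S(X)$. A configuration is globally admissible if it extends to an element of $X$; a row is a configuration on $\mathbb{Z}\times\{0\}$ (up to vertical translation). $X$ is strongly irreducible with filling distance $L$ if for all finite $S,T\subset\mathbb{Z}^2$ with $d(S,T)>L$ and all $x\in\mathcal{L}_S(X),y\in\mathcal{L}_T(X)$, the concatenation $xy$ is in $\mathcal{L}_{S\cup T}(X)$. Interaction: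 a translation-invariant n.n. interaction on $X$ is a function $\Phi:\mathcal{L}(X)\to\mathbb{R}$ taking equal values on translates and vanishing except on configurations whose shape is a single vertex or a single edge of $\mathbb{Z}^2$. Write $\Phi(a)$ for vertices, $\Phi(a,a')$ for a horizontal edge with $a$ left of $a'$, $\Phi\binom{a'}{a}$ for a vertical edge with $a'$ on top of $a$. Gibbs specification $\Lambda_{\Phi,X}$: for finite $S\subset\mathbb{Z}^2$ with outer boundary $\partial S$ (sites outside $S$ adjacent to $S$), $\delta\in\mathcal{L}_{\partial S}(X)$ and $x\in\mathcal{A}^S$ with $x\delta\in\mathcal{L}_{S\cup\partial S}(X)$, $\Lambda_{\Phi,X}^\delta(x)$ is proportional to $\exp\big(-\sum_{u\in S}\Phi(x(u))-\sum_e\Phi((x\delta)|_e)\big)$, where $e$ ranges over edges with at least one endpoint in $S$ (both endpoints in $S\cup\partial S$); $\Lambda^\delta_{\Phi,X}(x)=0$ if $x\delta\notin\mathcal{L}(X)$; it is normalized to be a probability measure on $\mathcal{A}^S$. For $\delta\notin\mathcal{L}_{\partial S}(X)$, $\Lambda^\delta_{\Phi,X}$ is set equal to $\Lambda^{\delta'}_{\Phi,X}$ for some arbitrary $\delta'\in\mathcal{L}_{\partial S}(X)$. $q(\Lambda_{\Phi,X})=\sup_{g\in\mathbb{Z}^2}\max_{\delta,\delta'\in\mathcal{A}^{\partial\{g\}}}d(\Lambda^\delta_{\Phi,X},\Lambda^{\delta'}_{\Phi,X})$, $d(\alpha,\beta)=\frac12\sum_s|\alpha(s)-\beta(s)|$.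 Induced Gibbs state: for a graph $G$, $\partial(S,G)$ is the set of vertices outside $S$ adjacent to $S$. A Borel probability measure $\mu$ on $\mathcal{A}^{V(G)}$ is a $G$-MRF if for every finite $S$, $\eta\in\mathcal{A}^S$, finite $T$ with $\partial(S,G)\subseteq T\subseteq V(G)\setminus S$ and $\delta\in\mathcal{A}^T$ with $\mu(\delta)\neq0$, $\mu(\eta\mid\delta|_{\partial(S,G)})=\mu(\eta\mid\delta)$ (finite configurations stand for their cylinder sets). $H_{m,n}$ is the induced subgraph of $\mathbb{Z}^2$ on $\mathbb{Z}\times[m,n]$. For finite $S\subset\mathbb{Z}\times[m,n]$ and $\delta\in\mathcal{A}^{\partial(S,H_{m,n})}$ put $\Lambda^\delta_{\Phi,X,m,n,t,b}=\Lambda_{\Phi,X}^\xi$, where $\xi\in\mathcal{A}^{\partial S}$ is $\delta$ supplemented by the symbols of $t$ on $\partial S\cap(\mathbb{Z}\times\{n+1\})$ and of $b$ on $\partial S\cap(\mathbb{Z}\times\{m-1\})$. Under the hypotheses there is a unique $H_{m,n}$-MRF $\mu$ with $\mu(\cdot\mid\delta)=\Lambda^\delta_{\Phi,X,m,n,t,b}$ for all finite $S\subset \mathbb{Z}\times[m,n]$ and all $\delta\in\mathcal{A}^{\partial(S,H_{m,n})}$ with $\mu(\delta)>0$; it is the induced Gibbs state $\mu_{\Phi,X,m,n,t,b}$. Transition matrix: $\mathcal{C}_{m,n,t,b}$ is the set of columns $x_m\dots x_n$ (bottom to top) with $(x_i,x_{i+1})\in\mathcal{E}_2$ for $m\le i<n$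 and $(b_0,x_m),(x_n,t_0)\in\mathcal{E}_2$; $\mathcal{E}_{m,n,t,b}$ is the set of pairs $(x_m\dots x_n,y_m\dots y_n)\in\mathcal{C}_{m,n,t,b}^2$ with $(x_i,y_i)\in\mathcal{E}_1$ for all $i$. $X_{m,n,t,b}$ is the n.n. $\mathbb{Z}$-SFT over $\mathcal{C}_{m,n,t,b}$ with allowed transitions $\mathcal{E}_{m,n,t,b}$; columns that do not appear in any element of $X_{m,n,t,b}$ are deleted from $\mathcal{C}_{m,n,t,b}$. For $(c,d)=(x_m\dots x_n,y_m\dots y_n)\in\mathcal{E}_{m,n,t,b}$ let $$\overline{\Phi}(c,d)=\sum_{i=m}^n\Phi(x_i)+\Phi\tbinom{x_m}{b_0}+\sum_{i=m}^{n-1}\Phi\tbinom{x_{i+1}}{x_i}+\Phi\tbinom{t_0}{x_n}+\sum_{i=m}^n\Phi(x_i,y_i).$$ Let $A$ be the matrix indexed by $\mathcal{C}_{m,n,t,b}$ with $A_{c,d}=e^{-\overline\Phi(c,d)}$ if $(c,d)\in\mathcal{E}_{m,n,t,b}$ and $A_{c,d}=0$ otherwise (it is primitive under the hypotheses), $\lambda(A)$ its Perron eigenvalue, and $v$ a positive right eigenvector: $Av=\lambda(A)v$. Then $(\Pi_{\Phi,X,m,n,t,b})_{c,d}=\dfrac{A_{c,d}\,v(d)}{\lambda(A)\,v(c)}$. A Markov chain is mixing if its transition matrix is primitive (some power has all entries positive). *)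

(* Defs.v *)
From HB Require Import structures.
From mathcomp Require Import all_boot all_order all_algebra finmap.
From mathcomp Require Import all_classical all_reals all_analysis.
From mathcomp Require Import complex.
Set Implicit Arguments.
Unset Strict Implicit.
Unset Printing Implicit Defensive.
Import Order.TTheory GRing.Theory Num.Theory.
Local Open Scope classical_set_scope.
Local Open Scope ring_scope.

(* A finite configuration, i.e. an element of A^S with S a finite set of
   vertices, is a w : {fmap V -> A} with domf w = S; FinMap turns a finite
   function x : {ffun S -> A} into such a w. *)
Definition cylinder (V : choiceType) (A : Type) (w : {fmap V -> A}) :
  set (V -> A) := [set x | forall v a, w.[? v]%fmap = Some a -> x v = a].

(* The set A^V with its product sigma-algebra; for A finite and V countable
   these are the Borel sets. The symbol a0 serves only to make the type
   pointed, as the measurable types of the library have to be. *)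
Definition config_sort (V : choiceType) (A : Type) (a0 : A) : Type := V -> A.
HB.instance Definition _ (V : choiceType) (A : Type) (a0 : A) :=
  gen_eqMixin (config_sort V a0).
HB.instance Definition _ (V : choiceType) (A : Type) (a0 : A) :=
  gen_choiceMixin (config_sort V a0).
HB.instance Definition _ (V : choiceType) (A : Type) (a0 : A) :=
  isPointed.Build (config_sort V a0) (fun=> a0).

Definition config (V : choiceType) (A : Type) (a0 : A) :=
  g_sigma_algebraType
    (range (@cylinder V A) : set (set (config_sort V a0))).
HB.instance Definition _ (V : choiceType) (A : Type) (a0 : A) :=
  Measurable.on (config V a0).

Definition cond_prob (T : Type) (R : realType) (mu : set T -> \bar R)
  (X Y : set T) : R := fine (mu (X `&` Y)) / fine (mu Y).

(* Membership in the boundary of S in the graph with adjacency relation adj. *)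
Definition in_boundary (V : choiceType) (adj : rel V) (S : {fset V}) (v : V) :
  bool := (v \notin S) && has (adj v) S.

Definition MRF (R : realType) (V : choiceType) (A : finType) (a0 : A)
  (adj : rel V) (mu : probability (config V a0) R) : Prop :=
  forall (S T : {fset V}) (eta : {ffun S -> A}) (delta : {ffun T -> A}),
    (forall v, in_boundary adj S v -> v \in T) ->
    [disjoint S & T]%fset ->
    mu (cylinder (FinMap delta)) != 0%E ->
    cond_prob mu (cylinder (FinMap eta))
      (cylinder (FinMap delta).[& [fset v in T | in_boundary adj S v]%fset]%fmap)
    = cond_prob mu (cylinder (FinMap eta)) (cylinder (FinMap delta)).

Definition e1 : int * int := (1, 0).
Definition e2 : int * int := (0, 1).

(* The graph (l^1) distance of Z^2. *)
Definition dist (u v : int * int) : nat := (`|u.1 - v.1| + `|u.2 - v.2|)%N.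
Definition neighbors (u v : int * int) : bool := dist u v == 1%N.

Definition nbrs (u : int * int) : seq (int * int) :=
  [:: u + e1; u - e1; u + e2; u - e2].

Definition outer_boundary (S : {fset (int * int)}) : {fset (int * int)} :=
  [fset v in flatten [seq nbrs u | u <- S] | v \notin S]%fset.

Definition SFT (A : finType) (E1 E2 : {set A * A}) : set (int * int -> A) :=
  [set x | forall u, (x u, x (u + e1)) \in E1 /\ (x u, x (u + e2)) \in E2].

Definition language (A : finType) (E1 E2 : {set A * A})
  (w : {fmap (int * int) -> A}) : Prop :=
  exists2 x, SFT E1 E2 x & cylinder w x.

Definition strongly_irreducible (A : finType) (E1 E2 : {set A * A}) (L : nat) :
  Prop :=
  forall w w' : {fmap (int * int) -> A},
    language E1 E2 w -> language E1 E2 w' ->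
    (forall u v, u \in domf w -> v \in domf w' -> (L < dist u v)%N) ->
    language E1 E2 (catf w w').

Definition const_row_admissible (A : finType) (E1 E2 : {set A * A}) (a : A) :
  Prop := exists2 x, SFT E1 E2 x & forall i, x (i, 0) = a.

Definition vertex_or_edge (S : {fset (int * int)}) : Prop :=
  (exists u, S = [fset u]%fset) \/
  (exists u v, neighbors u v /\ S = [fset u; v]%fset).

(* Only the values of Phi on the language of the SFT are meaningful. *)
Definition nn_interaction (R : realType) (A : finType) (E1 E2 : {set A * A})
  (Phi : {fmap (int * int) -> A} -> R) : Prop :=
  (forall (w w' : {fmap (int * int) -> A}) (v : int * int), language E1 E2 w ->
     (forall u, w'.[? u + v]%fmap = w.[? u]%fmap) -> Phi w' = Phi w) /\
  (forall w, language E1 E2 w -> ~ vertex_or_edge (domf w) -> Phi w = 0).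

Definition Phi_v (R : realType) (A : finType)
  (Phi : {fmap (int * int) -> A} -> R) (a : A) : R :=
  Phi [fmap].[0 <- a]%fmap.

Definition Phi_h (R : realType) (A : finType)
  (Phi : {fmap (int * int) -> A} -> R) (a a' : A) : R :=
  Phi [fmap].[0 <- a].[e1 <- a']%fmap.

(* [Phi_vert Phi a' a] has a' on top of a. *)
Definition Phi_vert (R : realType) (A : finType)
  (Phi : {fmap (int * int) -> A} -> R) (a' a : A) : R :=
  Phi [fmap].[0 <- a].[e2 <- a']%fmap.

(* The edges with at least one endpoint in S. *)
Definition edges (S : {fset (int * int)}) : {fset {fset (int * int)}} :=
  [fset [fset u; v] | u in S, v in nbrs u]%fset.

Definition energy (R : realType) (A : finType)
  (Phi : {fmap (int * int) -> A} -> R) (S : {fset (int * int)})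
  (w : {fmap (int * int) -> A}) : R :=
  \sum_(u <- S) Phi w.[& [fset u]%fset]%fmap + \sum_(e <- edges S) Phi w.[& e]%fmap.

Definition gibbs_weight (R : realType) (A : finType) (E1 E2 : {set A * A})
  (Phi : {fmap (int * int) -> A} -> R) (S : {fset (int * int)})
  (delta : {ffun outer_boundary S -> A}) (x : {ffun S -> A}) : R :=
  let w := catf (FinMap x) (FinMap delta) in
  if `[< language E1 E2 w >] then expR (- energy Phi S w) else 0.

Definition gibbs (R : realType) (A : finType) (E1 E2 : {set A * A})
  (Phi : {fmap (int * int) -> A} -> R) (S : {fset (int * int)})
  (delta : {ffun outer_boundary S -> A}) (x : {ffun S -> A}) : R :=
  gibbs_weight E1 E2 Phi delta x / \sum_y gibbs_weight E1 E2 Phi delta y.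

Definition specification (R : realType) (A : finType) : Type :=
  forall S : {fset (int * int)},
    {ffun outer_boundary S -> A} -> {ffun S -> A} -> R.

(* The choice of delta' for inadmissible delta is left open, so that Lam is
   any of the specifications given by such a choice. *)
Definition gibbs_specification (R : realType) (A : finType)
  (E1 E2 : {set A * A}) (Phi : {fmap (int * int) -> A} -> R)
  (Lam : specification R A) : Prop :=
  forall (S : {fset (int * int)}) (delta : {ffun outer_boundary S -> A}),
    (language E1 E2 (FinMap delta) -> Lam S delta = gibbs E1 E2 Phi delta) /\
    (~ language E1 E2 (FinMap delta) ->
       exists2 delta' : {ffun outer_boundary S -> A},
         language E1 E2 (FinMap delta') & Lam S delta = gibbs E1 E2 Phi delta').

Definition tv_dist (R : realType) (B : finType) (p p' : B -> R) : R :=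
  2^-1 * \sum_s `|p s - p' s|.

Definition q (R : realType) (A : finType) (Lam : specification R A) : R :=
  let bc g := {ffun outer_boundary [fset g]%fset -> A} in
  sup (range (fun g : int * int =>
    \big[Num.max/0]_(dd : bc g * bc g)
      tv_dist (Lam [fset g]%fset dd.1) (Lam [fset g]%fset dd.2))).

Definition strip (m n : int) : choiceType :=
  {u : int * int | m <= u.2 <= n}.

Definition strip_adjacent (m n : int) (u v : strip m n) : bool :=
  neighbors (val u) (val v).

(* A finite set of vertices of the strip is a finite set S of sites all of
   which satisfy [m <= u.2 <= n]. *)
Definition strip_boundary (m n : int) (S : {fset (int * int)}) :
  {fset (int * int)} := [fset v in outer_boundary S | m <= v.2 <= n]%fset.

Definition strip_cylinder (m n : int) (A : Type)
  (w : {fmap (int * int) -> A}) : set (strip m n -> A) :=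
  [set x | forall v a, w.[? val v]%fmap = Some a -> x v = a].

(* delta, supplemented by t0 on the row n + 1 and by b0 on the row m - 1. *)
Definition supplement (m n : int) (A : finType) (t0 b0 : A)
  (S : {fset (int * int)}) (delta : {ffun strip_boundary m n S -> A}) :
  {ffun outer_boundary S -> A} :=
  [ffun v => if (FinMap delta).[? val v]%fmap is Some a then a
             else if (val v).2 == n + 1 then t0 else b0].

Definition induced_gibbs_state (R : realType) (A : finType)
  (Lam : specification R A) (m n : int) (t0 b0 a0 : A)
  (mu : probability (config (strip m n) a0) R) : Prop :=
  MRF (@strip_adjacent m n) mu /\
  forall (S : {fset (int * int)}) (delta : {ffun strip_boundary m n S -> A}),
    (forall u, u \in S -> m <= u.2 <= n) ->
    (0 < mu (strip_cylinder (FinMap delta)))%E ->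
    forall x : {ffun S -> A},
      cond_prob mu (strip_cylinder (FinMap x)) (strip_cylinder (FinMap delta))
      = Lam S (supplement t0 b0 delta) x.

(* A column x_m ... x_n (for m <= n) is indexed by 'I_(n - m + 1), bottom to
   top: entry k is x_(m + k). *)
Definition column (A : finType) (m n : int) : finType :=
  {ffun 'I_(`|(n - m)%R|%N.+1) -> A}.

Definition column_allowed (A : finType) (E2 : {set A * A}) (m n : int)
  (t0 b0 : A) (c : column A m n) : bool :=
  [&& [forall k : 'I_(`|(n - m)%R|%N), (c (inord k), c (inord k.+1)) \in E2],
      (b0, c ord0) \in E2 & (c ord_max, t0) \in E2].

Definition columns_adjacent (A : finType) (E1 : {set A * A}) (m n : int)
  (c d : column A m n) : bool := [forall k, (c k, d k) \in E1].

Definition column_SFT (A : finType) (E1 E2 : {set A * A}) (m n : int)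
  (t0 b0 : A) : set (int -> column A m n) :=
  [set z | forall i, column_allowed E2 t0 b0 (z i) /\
                     columns_adjacent E1 (z i) (z (i + 1))].

(* The columns that remain after deleting those that do not appear in any
   element of the Z-SFT. *)
Definition columns (A : finType) (E1 E2 : {set A * A}) (m n : int)
  (t0 b0 : A) : {set column A m n} :=
  [set c | `[< exists z i, column_SFT E1 E2 t0 b0 z /\ z i = c >]]%SET.

Definition Phi_bar (R : realType) (A : finType)
  (Phi : {fmap (int * int) -> A} -> R) (m n : int) (t0 b0 : A)
  (c d : column A m n) : R :=
  \sum_k Phi_v Phi (c k)
  + Phi_vert Phi (c ord0) b0
  + \sum_(k < `|(n - m)%R|%N) Phi_vert Phi (c (inord k.+1)) (c (inord k))
  + Phi_vert Phi t0 (c ord_max)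
  + \sum_k Phi_h Phi (c k) (d k).

Definition column_matrix (R : realType) (A : finType) (E1 E2 : {set A * A})
  (Phi : {fmap (int * int) -> A} -> R) (m n : int) (t0 b0 : A) :
  'M[R]_#|columns E1 E2 m n t0 b0| :=
  \matrix_(i, j)
    let c := enum_val i in let d := enum_val j in
    if columns_adjacent E1 c d then expR (- Phi_bar Phi t0 b0 c d) else 0.

(* The real eigenvalue whose modulus is maximal among all complex
   eigenvalues. *)
Definition perron_eigenvalue (R : realType) (k : nat) (M : 'M[R]_k) : R :=
  xget 0 [set lam : R | eigenvalue M lam /\
    forall z : R[i]%C, eigenvalue (map_mx (real_complex R) M) z ->
      `|z| <= real_complex R lam].

Definition perron_vector (R : realType) (k : nat) (M : 'M[R]_k) : 'cV[R]_k :=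
  xget 0 [set v : 'cV[R]_k | (forall i, 0 < v i 0) /\ M *m v = perron_eigenvalue M *: v].

Definition transition_matrix (R : realType) (A : finType)
  (E1 E2 : {set A * A}) (Phi : {fmap (int * int) -> A} -> R) (m n : int)
  (t0 b0 : A) : 'M[R]_#|columns E1 E2 m n t0 b0| :=
  let M := column_matrix E1 E2 Phi m n t0 b0 in
  let v := perron_vector M in
  \matrix_(i, j) (M i j * v j 0 / (perron_eigenvalue M * v i 0)).

(* A configuration on the strip as a bi-infinite sequence of columns. When
   m <= n the vertex (i, m + k) lies in the strip, so that insub succeeds and
   the default a0 is not used. *)
Definition to_columns (A : finType) (m n : int) (a0 : A)
  (x : config (strip m n) a0) :
  config int ([ffun=> a0] : column A m n) :=
  fun i => [ffun k : 'I__ => odflt a0 (omap x (insub (i, m + (k : nat)%:Z)))].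

Definition translation_invariant (R : realType) (B : finType) (b0 : B)
  (nu : set (config int b0) -> \bar R) : Prop :=
  forall (k : int) (U : set (config int b0)), measurable U ->
    nu [set z | U (fun i => z (i + k))] = nu U.

Definition stochastic (R : realType) (k : nat) (P : 'M[R]_k) : Prop :=
  (forall i j, 0 <= P i j) /\ (forall i, \sum_j P i j = 1).

(* The state space is C; entry (i, j) of P is the probability of a transition
   from enum_val i to enum_val j. *)
Definition markov_chain (R : realType) (B : finType) (b0 : B)
  (C : {set B}) (P : 'M[R]_#|C|) (nu : set (config int b0) -> \bar R) : Prop :=
  [/\ stochastic P,
      nu [set z | forall i, z i \in C] = 1%E &
      forall (i : int) (k : nat) (w : 'I_k.+1 -> 'I_#|C|) (s : 'I_#|C|),
        let past := [set z : config int b0 |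
          forall j : 'I_k.+1, z (i - (j : nat)%:Z) = enum_val (w j)] in
        (0 < nu past)%E ->
        cond_prob nu [set z | z (i + 1) = enum_val s] past = P (w ord0) s].

Definition primitive (R : realType) (k : nat) (P : 'M[R]_k) : Prop :=
  exists2 r : nat, (0 < r)%N & forall i j, 0 < (P ^+ r) i j.

(* Main.v *)
(* The condition q < 1 makes the single-site conditional distributions for any two
   boundary conditions charge a common symbol. Refilling sites one parity class at a
   time, one can therefore overwrite a point of X by another one on any set of sites,
   changing it elsewhere only at neighbours of that set. Hence the rows t and b are
   compatible with every configuration charged by mu, mu has the Gibbs conditional
   probabilities with these rows as boundary condition, and the square of the column
   matrix A is positive, so that A has a Perron eigenvector.

   By the Gibbs formula on a box of columns, given its two end columns a path of
   columns has a conditional probability proportional to the product of the entries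
   of A along it, equivalently of Pi. When the end columns go to infinity, the
   contraction property of the powers of Pi shows that the probability of a path is
   g(first column) times the product of the entries of Pi along it, where g does not
   depend on the position. *)

Require Import Defs.
From HB Require Import structures.
From mathcomp Require Import all_boot all_order all_algebra finmap.
From mathcomp Require Import all_classical all_reals all_analysis.
From mathcomp Require Import complex.
From mathcomp Require Import ring lra zify.
Import Order.TTheory GRing.Theory Num.Theory.
Import numFieldNormedType.Exports.
Local Open Scope classical_set_scope.
Local Open Scope ring_scope.
Set Implicit Arguments.
Unset Strict Implicit.
Unset Printing Implicit Defensive.

(** * Paths with Markovian bridges *)

(** For an inadmissible boundary condition the specification is only known to be the law of some
    other, admissible one. Patterns charged by mu on the boundary inside the strip are completed by
    t and b with no guarantee that the result is admissible, and until this is proved the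
    conditional probabilities of mu say nothing about the true boundary. Admissibility is therefore
    obtained in two rounds: of charged patterns inside the strip alone, then, by gluing, together
    with the border rows.

    The Gibbs formula also conditions on both ends of a path, so the Markov property is not
    immediate: the quotient of a path probability by its weight may depend on the last column and on
    the length. As a function of these it is space-time harmonic for Pi (each value is the
    Pi-average of the values one step later), and a nonnegative function of this kind is constant
    when the powers of Pi contract uniformly. A second passage to the limit, towards minus infinity,
    removes the position. *)

Lemma geometric_le0 (R : realType) (x C a : R) :
  0 <= a < 1 -> (forall j, x <= C * a ^+ j) -> x <= 0.
Proof.
move=> /andP[a0 a1] h.
have c : (fun j => C * a ^+ j) @ \oo --> (C * 0 : R).
  by apply: cvgMr; apply: cvg_expr; rewrite ger0_norm.
rewrite mulr0 in c; rewrite leNgt; apply/negP => x0.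
have [k _ /(_ k (leqnn k)) hk] := cvgr_lt _ c _ x0.
by have := le_lt_trans (h k) hk; rewrite ltxx.
Qed.

(** Doeblin's argument: average [f s - f t] over [s] from row [i] and [t] from row [j]. The terms
    with [t = s] vanish, and for every [s] they carry mass at least [eta] in row [j]. *)
Lemma stochastic_contract (R : realType) (N : nat) (Q : 'M[R]_N) (eta K : R)
  (f : 'I_N -> R) :
  stochastic Q -> (forall i j, eta <= Q i j) ->
  (forall i j, `|f i - f j| <= K) ->
  forall i j, `|\sum_s Q i s * f s - \sum_s Q j s * f s| <= (1 - eta) * K.
Proof.
move=> [Q0 Q1] Qe fK i j.
have Qs (c : R) k : \sum_s Q k s * c = c by rewrite -mulr_suml Q1 mul1r.
rewrite -[X in _ - X](Qs _ i) -sumrB.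
apply: (le_trans (ler_norm_sum _ _ _)).
rewrite -[leRHS](Qs _ i); apply: ler_sum => s _.
rewrite -mulrBr normrM (ger0_norm (Q0 _ _)) ler_wpM2l //.
rewrite -[X in `|X - _|](Qs _ j) -sumrB (bigD1 s) //= subrr add0r.
have K0 : 0 <= K by apply: le_trans (fK i i).
apply: (le_trans (ler_norm_sum _ _ _)).
apply: (@le_trans _ _ (\sum_(t | t != s) Q j t * K)).
  apply: ler_sum => t _; rewrite -mulrBr normrM (ger0_norm (Q0 _ _)).
  by rewrite ler_wpM2l.
rewrite -mulr_suml ler_wpM2r //.
by have := Q1 j; rewrite (bigD1 s) //= => h; have := Qe j s; lra.
Qed.

Lemma stochastic_pow (R : realType) (N : nat) (P : 'M[R]_N) k :
  stochastic P -> stochastic (P ^+ k).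
Proof.
move=> [P0 P1]; elim: k => [|k [IH0 IH1]].
  split=> [i j|i]; first by rewrite expr0 mxE ler0n.
  rewrite expr0 (bigD1 i) //= big1 => [|j ji]; last by rewrite mxE eq_sym (negPf ji).
  by rewrite mxE eqxx addr0.
split=> [i j|i].
  by rewrite exprS mxE sumr_ge0 // => s _; rewrite mulr_ge0.
under eq_bigr do rewrite exprS mxE.
rewrite exchange_big /=; under eq_bigr do rewrite -mulr_sumr IH1 mulr1.
exact: P1.
Qed.

Lemma stochastic_pow_osc (R : realType) (N : nat) (Q : 'M[R]_N) (eta : R) k i j d :
  stochastic Q -> (forall i j, eta <= Q i j) ->
  `|(Q ^+ k) i d - (Q ^+ k) j d| <= (1 - eta) ^+ k.
Proof.
move=> sQ Qe; elim: k i j => [|k IH] i j.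
  rewrite !expr0 !mxE; case: (i == d); case: (j == d);
  by rewrite ?subrr ?normr0 ?subr0 ?sub0r ?normrN ?normr1.
rewrite !(exprS Q) !mxE exprS.
exact: (stochastic_contract (f := fun s => (Q ^+ k) s d)).
Qed.

Fixpoint path_weight (R : realType) (N : nat) (P : 'M[R]_N) (c : 'I_N)
    (s : seq 'I_N) : R :=
  if s is d :: s' then P c d * path_weight P d s' else 1.

Lemma path_weight_rcons (R : realType) (N : nat) (P : 'M[R]_N) c s d :
  path_weight P c (rcons s d) = path_weight P c s * P (last c s) d.
Proof.
by elim: s c => [|e s IH] c /=; rewrite ?mulr1 ?mul1r // IH mulrA.
Qed.

(** Single entries of [P] may vanish, so prescribed ends can be joined in two or more steps but
    perhaps not in one. The extra steps are spent at the front, since every row has a positive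
    entry. *)
Lemma positive_path (R : realType) (N : nat) (P : 'M[R]_N) k c d :
  stochastic P -> (forall i j, 0 < (P ^+ 2) i j) ->
  exists s, [/\ size s = k.+2, last c s = d & 0 < path_weight P c s].
Proof.
move=> [P0 P1] P2.
have ex (f : 'I_N -> R) : (forall i, 0 <= f i) -> 0 < \sum_i f i -> exists i, 0 < f i.
  move=> f0 s0; apply: contrapT => /forallNP nf; move: s0.
  by rewrite big1 ?ltxx // => i _; apply/le_anti; rewrite f0 leNgt andbT; apply/negP.
elim: k c => [|k IH] c.
  have := P2 c d; rewrite expr2 mxE => /ex[i|e he]; first exact: mulr_ge0.
  by exists [:: e; d]; split=> //=; rewrite mulr1.
have [||e he] := ex (fun e => P c e); rewrite ?P1 //.
have [s [sk sd sw]] := IH e.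
by exists (e :: s); rewrite /= sk; split => //; exact: mulr_gt0.
Qed.

(** [p i s] plays the role of the probability of reading [s] from position [i] on. The last
    hypothesis says that, given its ends and its length, a path is distributed like a [P]-path. *)
Lemma markov_of_bridges (R : realType) (N : nat) (P : 'M[R]_N)
  (p : int -> seq 'I_N -> R) :
  stochastic P -> (forall i j, 0 < (P ^+ 2) i j) ->
  (forall i s, 0 <= p i s) -> (forall i, p i [::] = 1) ->
  (forall i s, p (i + 1) s = \sum_c p i (c :: s)) ->
  (forall i s, p i s = \sum_c p i (rcons s c)) ->
  (forall i c s s', size s = size s' -> last c s = last c s' ->
     p i (c :: s) * path_weight P c s' = p i (c :: s') * path_weight P c s) ->
  exists g : 'I_N -> R, forall i c s, p i (c :: s) = g c * path_weight P c s.
Proof.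
move=> sP P2 p0 p1 pl pr br.
have [P0 P1] := sP.
have sQ : stochastic (P ^+ 2) by exact: stochastic_pow.
have [eta [eta0 Qe]] : exists eta : R, 0 < eta /\ forall i j, eta <= (P ^+ 2) i j.
  exists (\big[Order.min/1]_(ij : 'I_N * 'I_N) (P ^+ 2) ij.1 ij.2); split.
    by apply: lt_bigmin => // -[i j] _; exact: P2.
  move=> i j; pose F (ij : 'I_N * 'I_N) := (P ^+ 2) ij.1 ij.2.
  exact: (bigmin_le 1 (i, j) F).
(* H i k c d is the quotient of the probability of a path of k steps from c at time
   i to d by its weight; it does not depend on the path chosen. *)
have [H HE] : exists H : int -> nat -> 'I_N -> 'I_N -> R, forall i c s,
    p i (c :: s) = H i (size s) c (last c s) * path_weight P c s \/ (size s < 2)%N.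
  have: forall x : int * nat * 'I_N * 'I_N, exists h, forall s, (1 < size s)%N ->
      size s = x.1.1.2 -> last x.1.2 s = x.2 ->
      p x.1.1.1 (x.1.2 :: s) = h * path_weight P x.1.2 s.
    move=> [[[i k] c] d] /=; case: k => [|[|k]].
    - by exists 0 => s + s0; rewrite s0.
    - by exists 0 => s + s0; rewrite s0.
    have [s0 [s0k s0d s0w]] := positive_path k c d sP P2.
    exists (p i (c :: s0) / path_weight P c s0) => s _ sk sd.
    rewrite mulrAC -(br i c s s0) ?s0k ?sk ?s0d ?sd // mulfK //.
    by rewrite gt_eqF.
  move=> /boolp.choice[H HE]; exists (fun i k c d => H (i, k, c, d)) => i c s.
  have [s2|s2] := ltnP (size s) 2; first by right.
  by left; apply: (HE (i, size s, c, last c s)).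
have {}HE i c s : (1 < size s)%N ->
    p i (c :: s) = H i (size s) c (last c s) * path_weight P c s.
  by move=> s2; have [//|] := HE i c s; rewrite ltnNge s2.
have H0 i k c d : 0 <= H i k.+2 c d.
  have [s [sk sd sw]] := positive_path k c d sP P2.
  by rewrite -(pmulr_lge0 _ sw) -sk -sd -HE // sk.
(* Consistency on the right, divided by the weight of a positive path from [c] to [d]. *)
have Hr i k c d : H i k.+2 c d = \sum_e H i k.+3 c e * P d e.
  have [s [sk sd sw]] := positive_path k c d sP P2.
  apply: (mulIf (lt0r_neq0 sw)); rewrite -{1}sk -{1}sd -HE ?sk //.
  rewrite pr mulr_suml; apply: eq_bigr => e _.
  rewrite rcons_cons HE ?size_rcons ?sk // last_rcons path_weight_rcons sd; ring.
have HrM i k j c d : H i k.+2 c d = \sum_e H i (k + j).+2 c e * (P ^+ j) d e.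
  elim: j => [|j ->].
    rewrite addn0 (bigD1 d) //= big1 ?addr0 ?expr0 ?mxE ?eqxx ?mulr1 // => e ed.
    by rewrite mxE eq_sym (negPf ed) mulr0.
  rewrite addnS; under eq_bigr do rewrite Hr mulr_suml.
  rewrite exchange_big /=; apply: eq_bigr => e _.
  rewrite exprSr mxE mulr_sumr; apply: eq_bigr => f _; ring.
have [N0|Npos] := posnP N.
  by exists (fun=> 0) => i c; have := ltn_ord c; rewrite {2}N0.
pose o : 'I_N := Ordinal Npos.
have eta1 : 0 <= 1 - eta < 1.
  rewrite gtrBl eta0 andbT subr_ge0 (le_trans (Qe o o)) //.
  rewrite -(sQ.2 o) (bigD1 o) //= lerDl sumr_ge0 // => e _; exact: sQ.1.
(* This bound is uniform in the horizon: every entry of [P ^+ (2j + 2)] is at least [eta], so the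
   average of far values against row [o] controls their sum. The horizon is even so as to give
   powers of [P ^+ 2]. *)
have Hsum i k c j : \sum_e H i (k + j.*2.+2).+2 c e <= H i k.+2 c o / eta.
  rewrite ler_pdivlMr // (HrM i k j.*2.+2) mulr_suml; apply: ler_sum => e _.
  rewrite ler_wpM2l // -doubleS -mul2n exprM exprSr mxE.
  rewrite -[leLHS]mul1r -((stochastic_pow j sQ).2 o) mulr_suml.
  apply: ler_sum => f _; rewrite ler_wpM2l //; exact: (stochastic_pow j sQ).1.
have osc k i j d : `|(P ^+ k.*2) i d - (P ^+ k.*2) j d| <= (1 - eta) ^+ k.
  by rewrite -mul2n exprM; exact: stochastic_pow_osc.
(* Both sides average the same far values, against two rows of [P ^+ (2j + 2)] whose difference
   decays geometrically. *)
have Hd i k c d d' : H i k.+2 c d = H i k.+2 c d'.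
  apply/eqP; rewrite -subr_eq0 -normr_le0.
  apply: (geometric_le0 (C := H i k.+2 c o / eta) eta1) => j.
  have q1 : 0 <= 1 - eta <= 1 by case/andP: eta1 => -> /ltW.
  apply: (@le_trans _ _ (H i k.+2 c o / eta * (1 - eta) ^+ j.+1)); last first.
    rewrite ler_wpM2l ?divr_ge0 // ?(ltW eta0) // exprS ler_piMl ?exprn_ge0 //.
    + by case/andP: q1.
    + by case/andP: q1.
  rewrite (HrM i k j.*2.+2 c d) (HrM i k j.*2.+2 c d') -sumrB.
  apply: (le_trans (ler_norm_sum _ _ _)).
  apply: (le_trans _ (ler_wpM2r _ (Hsum i k c j))); last first.
    by rewrite exprn_ge0 //; case/andP: q1.
  rewrite mulr_suml; apply: ler_sum => e _.
  by rewrite -mulrBr normrM ger0_norm // ler_wpM2l // -doubleS.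
pose g i c := H i 2%N c o.
have Hg i k c d : H i k.+2 c d = g i c.
  rewrite (Hd i k c d o) /g; elim: k => // k <-.
  rewrite [RHS]Hr; under eq_bigr do rewrite (Hd i k.+1 c _ o).
  by rewrite -mulr_sumr P1 mulr1.
(* [HE] starts at two steps; shorter paths are sums over their extensions by one step, so the
   induction is on what is missing to length two. *)
have pg i c s : p i (c :: s) = g i c * path_weight P c s.
  have [k] := ubnP (2 - size s)%N; elim: k s => // k IH s.
  have [s2|s2] := ltnP 1 (size s).
    by move=> _; rewrite HE //; case: (size s) s2 => [|[]] // j _; rewrite Hg.
  move=> hk; rewrite pr; under eq_bigr => e _.
    rewrite rcons_cons IH ?size_rcons; last by lia.
    rewrite path_weight_rcons mulrA.
    over.
  by rewrite -mulr_sumr P1 mulr1.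
have g0 i c : 0 <= g i c by exact: H0.
have g1 i : \sum_c g i c = 1.
  by rewrite -(p1 (i + 1)) pl; apply: eq_bigr => c _; rewrite pg mulr1.
have gP i c : g (i + 1) c = \sum_e g i e * P e c.
  have := pl i [:: c]; rewrite pg mulr1 => ->.
  by apply: eq_bigr => e _; rewrite pg /= mulr1.
have gPM i j c : g i c = \sum_e g (i - j%:Z) e * (P ^+ j) e c.
  elim: j i => [|j IH] i.
    rewrite subr0 (bigD1 c) //= big1 ?addr0 ?expr0 ?mxE ?eqxx ?mulr1 // => e ed.
    by rewrite mxE (negPf ed) mulr0.
  rewrite IH [in LHS](_ : i - j%:Z = (i - j.+1%:Z) + 1); last by lia.
  under eq_bigr do rewrite gP mulr_suml.
  rewrite exchange_big /=; apply: eq_bigr => e _.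
  rewrite exprS mxE mulr_sumr; apply: eq_bigr => f _; ring.
(* Both laws are pulled back by [2k] steps and averaged over the product of the two past laws; their
   difference is then an average of oscillations in column [c] of [P ^+ (2k)]. *)
have gi i j c : g i c = g j c.
  apply/eqP; rewrite -subr_eq0 -normr_le0.
  apply: (geometric_le0 (C := 1) eta1) => k; rewrite mul1r.
  set i' := i - k.*2%:Z; set j' := j - k.*2%:Z.
  have -> : g i c = \sum_e \sum_f g i' e * g j' f * (P ^+ k.*2) e c.
    rewrite (gPM i k.*2); apply: eq_bigr => e _.
    by rewrite -mulr_suml -mulr_sumr g1 mulr1.
  have -> : g j c = \sum_e \sum_f g i' e * g j' f * (P ^+ k.*2) f c.
    rewrite (gPM j k.*2) exchange_big /=; apply: eq_bigr => f _.
    by rewrite -!mulr_suml g1 mul1r.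
  have gs l x : x = \sum_e g l e * x by rewrite -mulr_suml g1 mul1r.
  rewrite -sumrB [leRHS](gs i').
  apply: (le_trans (ler_norm_sum _ _ _)); apply: ler_sum => e _.
  rewrite -sumrB [leRHS](gs j').
  apply: (le_trans (ler_norm_sum _ _ _)); apply: ler_sum => f _.
  rewrite -mulrBr normrM ger0_norm ?mulr_ge0 //.
  by rewrite -mulrA [leRHS]mulrCA !ler_wpM2l.
by exists (g 0) => i c s; rewrite pg (gi i 0).
Qed.

(** * Perron eigenvectors *)

(** The value [r] is a coordinate of the compact set, instead of the minimum of the quotients
    [(M v)_i / v_i], which is not continuous where coordinates of [v] vanish. *)
Lemma collatz_wielandt_max (R : realType) (N : nat) (M : 'M[R]_N) :
  (0 < N)%N -> (forall i j, 0 <= M i j) ->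
  exists (v : 'rV[R]_N) (r : R),
    [/\ 0 <= r, forall i, 0 <= v ord0 i, \sum_i v ord0 i = 1,
        forall i, r * v ord0 i <= \sum_j M i j * v ord0 j &
        forall (w : 'I_N -> R) s, (forall i, 0 < w i) ->
          (forall i, s * w i <= \sum_j M i j * w j) -> s <= r].
Proof.
move=> N0 M0; pose o := Ordinal N0.
(* Summing [r v <= M v] over the coordinates of a vector in the simplex gives [r <= B], so cutting
   [r] at [B] excludes no candidate. *)
pose B := \sum_i \sum_j M i j.
have B0 : 0 <= B by rewrite sumr_ge0 // => i _; rewrite sumr_ge0.
pose K : set ('rV[R]_N * R) :=
  ([set v : 'rV[R]_N | forall i, v ord0 i \in `[0, 1]] `*` `[0, B]%classic)
  `&` ((fun p : 'rV[R]_N * R => \sum_i p.1 ord0 i - 1) @^-1` [set 0])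
  `&` \bigcap_(i in setT)
    ((fun p : 'rV[R]_N * R => \sum_j M i j * p.1 ord0 j - p.2 * p.1 ord0 i)
      @^-1` [set x : R | 0 <= x]).
have cc (i : 'I_N) : continuous (fun p : 'rV[R]_N * R => p.1 ord0 i).
  move=> p; apply: (@continuous_comp _ _ _ fst (fun v : 'rV[R]_N => v ord0 i)).
    exact: cvg_fst.
  exact: coord_continuous.
have cs (a : 'I_N -> R) : continuous (fun p : 'rV[R]_N * R => \sum_j a j * p.1 ord0 j).
  apply: continuous_big => [|j _ p]; first exact: add_continuous.
  by apply: cvgMr; exact: cc.
have cK : compact K.
  apply: compact_closedI; last first.
    apply: closed_bigI => i _; apply: preimage_closed; last exact: closed_ge.
    move=> p _; apply: cvgB; first exact: cs.
    by apply: cvgM; [exact: cvg_snd|exact: cc].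
  apply: compact_closedI; last first.
    apply: preimage_closed; last exact: closed_eq.
    move=> p _; apply: cvgB; last exact: cvg_cst.
    have <- : (fun p : 'rV[R]_N * R => \sum_j 1 * p.1 ord0 j) = (fun p => \sum_j p.1 ord0 j).
      by apply/funext => u; apply: eq_bigr => j _; rewrite mul1r.
    have <- : \sum_j 1 * p.1 ord0 j = \sum_j p.1 ord0 j.
      by apply: eq_bigr => j _; rewrite mul1r.
    exact: cs.
  apply: compact_setX; last exact: segment_compact.
  exact: (@rV_compact R N (fun=> `[0, 1]%classic) (fun=> @segment_compact R 0 1)).
have K1 (w : 'I_N -> R) s : (forall i, 0 < w i) -> 0 <= s ->
    (forall i, s * w i <= \sum_j M i j * w j) ->
    K (\row_i (w i / \sum_j w j), s).
  move=> w0 s0 sw.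
  have W0 : 0 < \sum_j w j.
    by rewrite (bigD1 o) //= ltr_pwDl // sumr_ge0 // => i _; exact: ltW.
  split; [split; [split|]|].
  - move=> i /=; rewrite mxE in_itv /= divr_ge0 ?(ltW (w0 _)) ?(ltW W0) //=.
    rewrite ler_pdivrMr // mul1r (bigD1 i) //= lerDl sumr_ge0 // => j _; exact: ltW.
  - rewrite /= in_itv /= s0 /= -(ler_pM2r W0).
    rewrite mulr_sumr; apply: (@le_trans _ _ (\sum_i \sum_j M i j * w j)).
      by apply: ler_sum => i _; exact: sw.
    rewrite /B mulr_suml; apply: ler_sum => i _; rewrite mulr_suml.
    apply: ler_sum => j _; rewrite ler_wpM2l // (bigD1 j) //= lerDl sumr_ge0 // => k _.
    exact: ltW.
  - rewrite /=; under eq_bigr do rewrite mxE.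
    by rewrite -mulr_suml divff ?subrr // gt_eqF.
  - move=> i _ /=; rewrite mxE; under eq_bigr do rewrite mxE mulrA.
    by rewrite -mulr_suml mulrA -mulrBl divr_ge0 ?(ltW W0) // subr_ge0.
have K0 : K !=set0.
  exists (\row_i ((fun=> 1) i / \sum_(j : 'I_N) (fun=> 1) j), 0); apply: K1 => // i.
  by rewrite mul0r sumr_ge0 // => j _; rewrite mulr1.
have [[v r] Kv rmax] : exists2 c : 'rV[R]_N * R, c \in K & forall t, t \in K -> t.2 <= c.2.
  apply: compact_EVT_max => //; apply: continuous_subspaceT => p; exact: cvg_snd.
move: Kv; rewrite inE => -[[[/= Kv]]]; rewrite in_itv /= => /andP[r0 _] v1 rv.
exists v, r; split => //.
- by move=> i; have := Kv i; rewrite in_itv /= => /andP[].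
- by apply/eqP; rewrite -subr_eq0; apply/eqP.
- by move=> i; have := rv i I; rewrite /= subr_ge0.
move=> w s w0 sw; have [s0|s0] := leP 0 s; last by rewrite (le_trans (ltW s0)).
by apply: (rmax (_, s)); rewrite inE; exact: K1 w0 s0 sw.
Qed.

(* A maximiser of the Collatz-Wielandt quotient is an eigenvector: otherwise
   applying M ^+ 2 makes all the inequalities strict. *)
Lemma perron_exists (R : realType) (N : nat) (M : 'M[R]_N) :
  (0 < N)%N -> (forall i j, 0 <= M i j) -> (forall i j, 0 < (M ^+ 2) i j) ->
  exists lam (v : 'cV[R]_N),
    [/\ 0 < lam, forall i, 0 < v i 0 & M *m v = lam *: v].
Proof.
move=> N0 M0 M2; have [v [r [r0 v0 v1 rv rmax]]] := collatz_wielandt_max N0 M0.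
pose o := Ordinal N0.
pose V := v^T; have VE i : V i 0 = v ord0 i by rewrite mxE.
have MVE i : (M *m V) i 0 = \sum_j M i j * v ord0 j.
  by rewrite mxE; apply: eq_bigr => j _; rewrite VE.
have pos (u : 'cV[R]_N) k : (forall i, 0 <= u i 0) -> 0 < u k 0 ->
    forall i, 0 < ((M ^+ 2) *m u) i 0.
  move=> u0 uk i; rewrite mxE (bigD1 k) //= ltr_pwDl ?mulr_gt0 // sumr_ge0 // => j _.
  by rewrite mulr_ge0 // ltW.
have [k vk] : exists k, 0 < v ord0 k.
  apply: contrapT => /forallNP nv; move: v1; rewrite big1 => [/eqP|i _].
    by rewrite eq_sym oner_eq0.
  by apply/le_anti; rewrite v0 andbT leNgt; apply/negP.
have w0 i : 0 < ((M ^+ 2) *m V) i 0.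
  by apply: (pos _ k); [move=> j|]; rewrite VE.
have eqV : M *m V = r *: V.
  apply: contrapT => neq; pose u := M *m V - r *: V.
  have u0 i : 0 <= u i 0.
    by have := rv i; rewrite /u !mxE -MVE !mxE subr_ge0.
  have [l ul] : exists l, 0 < u l 0.
    apply: contrapT => /forallNP nu; apply: neq; apply/subr0_eq/matrixP => i j.
    rewrite [RHS]mxE ord1; apply/le_anti; rewrite u0 andbT leNgt.
    by apply/negP/nu.
  have := pos u l u0 ul; set x := (M ^+ 2) *m u => x0.
  set w := (M ^+ 2) *m V in w0.
  have xE i : \sum_j M i j * w j 0 = r * w i 0 + x i 0.
    have -> : \sum_j M i j * w j 0 = (M *m w) i 0 by rewrite [RHS]mxE.
    have -> : r * w i 0 = (r *: w) i 0 by rewrite [RHS]mxE.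
    have -> : M *m w = r *: w + x; last by rewrite [LHS]mxE.
    rewrite /x /w /u mulmxBr -scalemxAr addrC subrK !mulmxA; congr (_ *m V).
  (* By this choice [e w <= x], so the positive vector [w] would allow the value [r + e]. *)
  pose e := \big[Order.min/1]_i (x i 0 / w i 0).
  have e0 : 0 < e by apply: lt_bigmin => // i _; exact: divr_gt0.
  have : r + e <= r.
    apply: (rmax (fun i => w i 0)) => // i; rewrite xE mulrDl lerD2l.
    by rewrite -ler_pdivlMr //; exact: (bigmin_le 1 i (fun i => x i 0 / w i 0)).
  by rewrite gerDl leNgt e0.
have wE : (M ^+ 2) *m V = r ^+ 2 *: V.
  by rewrite expr2 -mulmxE -mulmxA eqV -scalemxAr eqV scalerA.
have rp : 0 < r.
  rewrite lt_neqAle r0 andbT; apply/eqP => r_0; have := w0 o.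
  by rewrite wE -r_0 expr0n /= scale0r mxE ltxx.
exists r, V; split => // i.
by have := w0 i; rewrite wE mxE pmulr_rgt0 // exprn_gt0.
Qed.

(** [eigenvalue] refers to row eigenvectors; if [a] were not one, [M - a] would be invertible and
    could not annihilate the column [v]. *)
Lemma eigenvalue_right (F : fieldType) (N : nat) (M : 'M[F]_N) (a : F) (v : 'cV[F]_N) :
  M *m v = a *: v -> v != 0 -> eigenvalue M a.
Proof.
move=> Mv; apply: contraNT; rewrite /eigenvalue /eigenspace negbK kermx_eq0.
rewrite row_free_unit => u; apply/eqP.
by rewrite -[v](mulKmx u) mulmxBl Mv mul_scalar_mx subrr mulmx0.
Qed.

(** Pair the moduli of a complex row eigenvector [u] with the positive column [v]: the triangle
    inequality gives [|z| s <= lam s] with [s] the sum of [|u_j| v_j], which is positive. *)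
Lemma eigenvalue_norm_le (R : realType) (N : nat) (M : 'M[R]_N) (lam : R)
    (v : 'cV[R]_N) (z : R[i]) :
  (forall i j, 0 <= M i j) -> (forall i, 0 < v i 0) -> M *m v = lam *: v ->
  eigenvalue (map_mx (real_complex R) M) z -> `|z| <= real_complex R lam.
Proof.
move=> M0 v0 Mv /eigenvalueP[u uM u0].
pose rc := real_complex R.
pose s := \sum_j `|u 0 j| * rc (v j 0).
have rc0 (x : R) : 0 <= x -> 0 <= rc x by move=> x0; rewrite /rc lecR.
have s0 : 0 < s.
  have [j uj] := rV0Pn _ u0.
  rewrite /s (bigD1 j) //= ltr_pwDl ?mulr_gt0 ?normr_gt0 ?ltcR // sumr_ge0 // => k _.
  by apply: mulr_ge0 => //; apply/rc0/ltW.
rewrite -(ler_pM2r s0) /s !mulr_sumr.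
have -> : \sum_j rc lam * (`|u 0 j| * rc (v j 0)) =
    \sum_j \sum_i `|u 0 i| * rc (M i j) * rc (v j 0).
  rewrite exchange_big /=; apply: eq_bigr => i _.
  under eq_bigr do rewrite -mulrA -rmorphM.
  rewrite -mulr_sumr -rmorph_sum mulrCA -rmorphM; congr (_ * rc _).
  by move/matrixP/(_ i 0): Mv; rewrite !mxE.
apply: ler_sum => j _; rewrite mulrA -mulr_suml -normrM; apply: ler_wpM2r; first exact/rc0/ltW.
have <- : (u *m map_mx rc M) 0 j = z * u 0 j by rewrite uM mxE.
rewrite mxE; apply: (le_trans (ler_norm_sum _ _ _)); apply: ler_sum => i _.
by rewrite mxE normrM [X in _ * X]ger0_norm ?rc0.
Qed.

(** This resolves the two choice operators. A real eigenvalue [y] that also dominates all moduli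
    satisfies [|y| <= lam <= y], so the eigenvalue is unique; the vector is just some positive
    eigenvector. *)
Lemma perron_spec (R : realType) (N : nat) (M : 'M[R]_N) :
  (0 < N)%N -> (forall i j, 0 <= M i j) -> (forall i j, 0 < (M ^+ 2) i j) ->
  [/\ 0 < perron_eigenvalue M, forall i, 0 < perron_vector M i 0 &
      M *m perron_vector M = perron_eigenvalue M *: perron_vector M].
Proof.
move=> N0 M0 M2; have [lam [v [lam0 v0 Mv]]] := perron_exists N0 M0 M2.
have vn0 : v != 0.
  by apply/cV0Pn; exists (Ordinal N0); rewrite gt_eqF.
have lamE : eigenvalue M lam by exact: eigenvalue_right Mv vn0.
have mapE x : eigenvalue M x -> eigenvalue (map_mx (real_complex R) M) (real_complex R x).
  move=> /eigenvalueP[u uM u0]; apply/eigenvalueP; exists (map_mx (real_complex R) u).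
    by rewrite -map_mxM uM map_mxZ.
  by rewrite map_mx_eq0.
have lamP : perron_eigenvalue M = lam.
  apply: xget_unique => [|y [yE ymax]].
    by split=> // z; exact: eigenvalue_norm_le M0 v0 Mv.
  have := ymax _ (mapE _ lamE); have := eigenvalue_norm_le M0 v0 Mv (mapE _ yE).
  move=> yl ly; have y0 : 0 <= y by rewrite -lecR; exact: le_trans (normr_ge0 _) ly.
  move: yl ly; rewrite !ger0_norm ?lecR ?(ltW lam0) // => yl ly.
  by apply/le_anti/andP.
rewrite /perron_vector lamP; case: xgetP => [w _ [w0 Mw]|h]; first by split.
by case: (h v); split.
Qed.


(** The values of [v] telescope, so the correction factor depends on the ends and the length of the
    path only: passing from [M] to its Doob transform does not change bridges. *)
Lemma path_weight_doob (R : realType) (N : nat) (M : 'M[R]_N) (lam : R)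
    (v : 'cV[R]_N) c s :
  0 < lam -> (forall i, 0 < v i 0) ->
  path_weight (\matrix_(i, j) (M i j * v j 0 / (lam * v i 0))) c s
  = path_weight M c s * (v (last c s) 0 / (lam ^+ size s * v c 0)).
Proof.
move=> lam0 v0; elim: s c => [|d s IH] c /=.
  by rewrite expr0 !mul1r divff // gt_eqF.
rewrite IH mxE exprS.
have := lt0r_neq0 lam0; have := lt0r_neq0 (v0 c); have := lt0r_neq0 (v0 d).
have := lt0r_neq0 (exprn_gt0 (size s) lam0).
by move=> *; field; do ?[apply/andP; split].
Qed.

Lemma stochastic_doob (R : realType) (N : nat) (M : 'M[R]_N) (lam : R)
    (v : 'cV[R]_N) :
  (forall i j, 0 <= M i j) -> (forall i j, 0 < (M ^+ 2) i j) ->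
  0 < lam -> (forall i, 0 < v i 0) -> M *m v = lam *: v ->
  let P := \matrix_(i, j) (M i j * v j 0 / (lam * v i 0)) in
  stochastic P /\ forall i j, 0 < (P ^+ 2) i j.
Proof.
move=> M0 M2 lam0 v0 Mv P.
have lv i : 0 < lam * v i 0 by exact: mulr_gt0.
split; first split=> [i j|i].
- by rewrite mxE divr_ge0 ?(ltW (lv _)) // mulr_ge0 // ltW.
- under eq_bigr do rewrite mxE.
  rewrite -mulr_suml; move/matrixP/(_ i 0): Mv; rewrite !mxE => ->.
  by rewrite divff // gt_eqF.
move=> i j; have -> : (P ^+ 2) i j = (M ^+ 2) i j * (v j 0 / (lam ^+ 2 * v i 0)).
  rewrite !expr2 !mxE mulr_suml; apply: eq_bigr => k _; rewrite !mxE.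
  have := lt0r_neq0 lam0; have := lt0r_neq0 (v0 i); have := lt0r_neq0 (v0 k).
  by move=> *; field; do ?[apply/andP; split].
by rewrite mulr_gt0 // divr_gt0 // mulr_gt0 // exprn_gt0.
Qed.

(** * Gluing points of the SFT *)

Lemma fnd_FinMap (V : choiceType) (A : Type) (S : {fset V}) (x : {ffun S -> A}) (u : S) :
  (FinMap x).[? val u]%fmap = Some (x u).
Proof. by rewrite (in_fnd (f := FinMap x) (valP u)); congr (Some (x _)); apply/val_inj. Qed.

Lemma fnd_FinMapN (V : choiceType) (A : Type) (S : {fset V}) (x : {ffun S -> A}) u :
  u \notin S -> (FinMap x).[? u]%fmap = None.
Proof. exact: (@not_fnd _ _ (FinMap x)). Qed.

Lemma cylinderP (V : choiceType) (A : Type) (S : {fset V}) (x : {ffun S -> A})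
    (y : V -> A) :
  cylinder (FinMap x) y <-> forall u : S, y (val u) = x u.
Proof.
split=> [h u|h v a]; first by apply: h; rewrite fnd_FinMap.
have [vS|vS] := boolP (v \in S); last by rewrite fnd_FinMapN.
by rewrite (fnd_FinMap x [` vS]%fset) => -[<-]; rewrite -h.
Qed.

Lemma cylinder_catfP (V : choiceType) (A : Type) (S T : {fset V})
    (x : {ffun S -> A}) (d : {ffun T -> A}) (y : V -> A) :
  (forall u, u \in T -> u \notin S) ->
  cylinder (catf (FinMap x) (FinMap d)) y <->
  (forall u : S, y (val u) = x u) /\ (forall u : T, y (val u) = d u).
Proof.
move=> dis; split=> [h|[hS hT] v a]; [split=> u|].
- apply: h; rewrite fnd_cat ifF ?fnd_FinMap //.
  by apply/negbTE/negP => /dis; rewrite (valP u).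
- by apply: h; rewrite fnd_cat (valP u) fnd_FinMap.
rewrite fnd_cat; case: ifPn => [vT|vT].
  by rewrite (fnd_FinMap d [` vT]%fset) => -[<-]; rewrite -hT.
have [vS|vS] := boolP (v \in S); last by rewrite fnd_FinMapN.
by rewrite (fnd_FinMap x [` vS]%fset) => -[<-]; rewrite -hS.
Qed.

Lemma outer_boundaryP (S : {fset (int * int)}) v :
  reflect (v \notin S /\ exists2 u, u \in S & v \in nbrs u) (v \in outer_boundary S).
Proof.
rewrite /outer_boundary !inE /= andbC; apply: (iffP andP) => -[vS].
  by move=> /flattenP[_ /mapP[u uS ->] vu]; split => //; exists u.
by move=> [u uS vu]; split => //; apply/flattenP; exists (nbrs u) => //; apply/mapP; exists u.
Qed.

Lemma nbrs_sym u v : (v \in nbrs u) = (u \in nbrs v).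
Proof.
rewrite !inE; apply/idP/idP => /or4P[] /eqP ->;
by rewrite ?addrK ?subrK eqxx ?orbT.
Qed.

Lemma language_weight (A : finType) (E1 E2 : {set A * A}) (S : {fset (int * int)})
    (d : {ffun outer_boundary S -> A}) (x : {ffun S -> A}) :
  language E1 E2 (catf (FinMap x) (FinMap d)) <->
  exists2 y, SFT E1 E2 y &
    (forall u : S, y (val u) = x u) /\ (forall u : outer_boundary S, y (val u) = d u).
Proof.
have dis u : u \in outer_boundary S -> u \notin S by case/outer_boundaryP.
by split=> -[y Xy]; [move/(cylinder_catfP _ _ _ dis)|]; exists y => //; apply/cylinder_catfP.
Qed.

Lemma language_cylinder (A : finType) (E1 E2 : {set A * A}) (T : {fset (int * int)})
    (d : {ffun T -> A}) :
  language E1 E2 (FinMap d) <->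
  exists2 y, SFT E1 E2 y & forall u : T, y (val u) = d u.
Proof. by split=> -[y Xy] /cylinderP; exists y => //; apply/cylinderP. Qed.

Lemma gibbs_weight_ge0 (R : realType) (A : finType) (E1 E2 : {set A * A})
    (Phi : {fmap (int * int) -> A} -> R) (S : {fset (int * int)})
    (d : {ffun outer_boundary S -> A}) x :
  0 <= gibbs_weight E1 E2 Phi d x.
Proof. by rewrite /gibbs_weight; case: ifP => // _; exact: expR_ge0. Qed.

Lemma gibbs_weight_gt0 (R : realType) (A : finType) (E1 E2 : {set A * A})
    (Phi : {fmap (int * int) -> A} -> R) (S : {fset (int * int)})
    (d : {ffun outer_boundary S -> A}) x :
  0 < gibbs_weight E1 E2 Phi d x <-> language E1 E2 (catf (FinMap x) (FinMap d)).
Proof.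
rewrite /gibbs_weight; case: asboolP => h; first by rewrite expR_gt0.
by rewrite ltxx.
Qed.

Lemma gibbs_partition_gt0 (R : realType) (A : finType) (E1 E2 : {set A * A})
    (Phi : {fmap (int * int) -> A} -> R) (S : {fset (int * int)})
    (d : {ffun outer_boundary S -> A}) :
  language E1 E2 (FinMap d) -> 0 < \sum_x gibbs_weight E1 E2 Phi d x.
Proof.
move=> /language_cylinder[y Xy yd]; rewrite (bigD1 [ffun u : S => y (val u)]) //=.
rewrite ltr_pwDl ?sumr_ge0 // => [|x _]; last exact: gibbs_weight_ge0.
by apply/gibbs_weight_gt0/language_weight; exists y => //; split => // u; rewrite ffunE.
Qed.

(** * Overlap of the single-site laws *)

Lemma specification_gibbs (R : realType) (A : finType) (E1 E2 : {set A * A})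
    (Phi : {fmap (int * int) -> A} -> R) (Lam : specification R A) S d :
  gibbs_specification E1 E2 Phi Lam ->
  exists2 d' : {ffun outer_boundary S -> A},
    language E1 E2 (FinMap d') & Lam S d = gibbs E1 E2 Phi d'.
Proof.
move=> /(_ S d)[h1 h2]; have [l|l] := pselect (language E1 E2 (FinMap d)).
  by exists d => //; exact: h1.
exact: h2.
Qed.

Lemma specification_ge0 (R : realType) (A : finType) (E1 E2 : {set A * A})
    (Phi : {fmap (int * int) -> A} -> R) (Lam : specification R A) S d x :
  gibbs_specification E1 E2 Phi Lam -> 0 <= Lam S d x.
Proof.
move=> /(specification_gibbs d)[d' l ->].
by rewrite divr_ge0 ?gibbs_weight_ge0 ?sumr_ge0 // => y _; exact: gibbs_weight_ge0.
Qed.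

Lemma specification_sum1 (R : realType) (A : finType) (E1 E2 : {set A * A})
    (Phi : {fmap (int * int) -> A} -> R) (Lam : specification R A) S d :
  gibbs_specification E1 E2 Phi Lam -> \sum_x Lam S d x = 1.
Proof.
move=> /(specification_gibbs d)[d' l ->].
by rewrite -mulr_suml divff // gt_eqF // gibbs_partition_gt0.
Qed.

Lemma tv_dist_lt1 (R : realType) (A : finType) (E1 E2 : {set A * A})
    (Phi : {fmap (int * int) -> A} -> R) (Lam : specification R A) g
    (d d' : {ffun outer_boundary [fset g]%fset -> A}) :
  gibbs_specification E1 E2 Phi Lam -> q Lam < 1 ->
  tv_dist (Lam [fset g]%fset d) (Lam [fset g]%fset d') < 1.
Proof.
move=> hLam; apply: le_lt_trans.
pose bc g := {ffun outer_boundary [fset g]%fset -> A} : finType.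
pose F h := \big[Num.max/0]_(dd : bc h * bc h)
  tv_dist (Lam [fset h]%fset dd.1) (Lam [fset h]%fset dd.2).
apply: (@le_trans _ _ (F g)); first exact: (le_bigmax _ _ (d, d')).
apply: ub_le_sup; last by exists g.
(* [sup] dominates the members of its set only when that set is bounded; total variation distances
   are at most 1. *)
exists 1 => _ [h _ <-]; apply: bigmax_le => // -[c c'] _ /=.
rewrite /tv_dist mulrC ler_pdivrMr // mul1r -[2]/(1 + 1).
rewrite -{1}(specification_sum1 c hLam) -(specification_sum1 c' hLam) -big_split.
apply: ler_sum => s _; apply: (le_trans (ler_normB _ _)).
by rewrite !ger0_norm //; exact: specification_ge0.
Qed.

(** Two probability laws with disjoint supports are at total variation distance exactly 1. *)
Lemma specification_overlap (R : realType) (A : finType) (E1 E2 : {set A * A})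
    (Phi : {fmap (int * int) -> A} -> R) (Lam : specification R A) g
    (d d' : {ffun outer_boundary [fset g]%fset -> A}) :
  gibbs_specification E1 E2 Phi Lam -> q Lam < 1 ->
  exists s, 0 < Lam [fset g]%fset d s /\ 0 < Lam [fset g]%fset d' s.
Proof.
move=> hLam /(tv_dist_lt1 d d' hLam) tv; apply: contrapT => /forallNP h.
have : tv_dist (Lam [fset g]%fset d) (Lam [fset g]%fset d') = 1; last first.
  by move=> e; rewrite e ltxx in tv.
rewrite /tv_dist; under eq_bigr => s _.
  have -> : `|Lam [fset g]%fset d s - Lam [fset g]%fset d' s| =
     Lam [fset g]%fset d s + Lam [fset g]%fset d' s.
    have := specification_ge0 d s hLam; have := specification_ge0 d' s hLam.
    rewrite !le_eqVlt => /predU1P[<-|p'] /predU1P[<-|p].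
    - by rewrite subrr addr0 normr0.
    - by rewrite subr0 addr0 gtr0_norm.
    - by rewrite sub0r add0r normrN gtr0_norm.
    - by case: (h s).
  over.
by rewrite big_split /= !(specification_sum1 _ hLam); field.
Qed.

Definition fits (A : finType) (E1 E2 : {set A * A}) (y : int * int -> A) g a :=
  [&& (a, y (g + e1)) \in E1, (y (g - e1), a) \in E1,
      (a, y (g + e2)) \in E2 & (y (g - e2), a) \in E2].

Lemma nbrs_neq u v : v \in nbrs u -> v != u.
Proof.
by case: u => i j; rewrite !inE => /or4P[] /eqP ->; apply/eqP => -[]; lia.
Qed.

Lemma boundary_fset1 g v : v \in nbrs g -> v \in outer_boundary [fset g]%fset.
Proof.
move=> vg; apply/outer_boundaryP; split; first by rewrite inE nbrs_neq.
by exists g => //; rewrite inE.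
Qed.

(** The neighbourhoods of [g] in [y] and in [z] are admissible boundary conditions, so a symbol
    charged under both completes each of them to a pattern of X; in particular it respects the four
    edges at [g]. *)
Lemma common_fill (R : realType) (A : finType) (E1 E2 : {set A * A})
    (Phi : {fmap (int * int) -> A} -> R) (Lam : specification R A) y z g :
  gibbs_specification E1 E2 Phi Lam -> q Lam < 1 ->
  SFT E1 E2 y -> SFT E1 E2 z ->
  exists a, fits E1 E2 y g a && fits E1 E2 z g a.
Proof.
move=> hLam hq Xy Xz.
pose d (x : int * int -> A) : {ffun outer_boundary [fset g]%fset -> A} :=
  [ffun u => x (val u)].
have [s [sy sz]] := specification_overlap (d y) (d z) hLam hq.
have gg : g \in [fset g]%fset by rewrite inE.
have pos x : SFT E1 E2 x -> 0 < Lam [fset g]%fset (d x) s -> fits E1 E2 x g (s [` gg]%fset).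
  move=> Xx; have lx : language E1 E2 (FinMap (d x)).
    by apply/language_cylinder; exists x => // u; rewrite ffunE.
  rewrite (hLam _ _).1 // /gibbs pmulr_lgt0 ?invr_gt0 ?gibbs_partition_gt0 //.
  move=> /gibbs_weight_gt0/language_weight[w Xw [ws wd]].
  have wn v : v \in nbrs g -> w v = x v.
    by move=> /boundary_fset1 vg; rewrite (wd [` vg]%fset) ffunE.
  have -> : s [` gg]%fset = w g by rewrite -ws.
  rewrite /fits -!wn ?inE ?eqxx ?orbT //.
  by rewrite (Xw g).1 (Xw g).2 -{2}(subrK e1 g) -{4}(subrK e2 g) (Xw (g - e1)).1 (Xw (g - e2)).2.
by exists (s [` gg]%fset); rewrite !pos.
Qed.

Definition parity (u : int * int) : bool := odd (absz (u.1 + u.2)).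

Lemma parity_e1 u : parity (u + e1) = ~~ parity u.
Proof. by case: u => i j; rewrite /parity /=; lia. Qed.

Lemma parity_e2 u : parity (u + e2) = ~~ parity u.
Proof. by case: u => i j; rewrite /parity /=; lia. Qed.

(** Sites of equal parity are never adjacent, so each edge has at most one changed end and the new
    symbol is only tested against old symbols of [y]. *)
Lemma refill (A : finType) (E1 E2 : {set A * A}) (y : int * int -> A)
    (f : int * int -> A) (U : pred (int * int)) b :
  SFT E1 E2 y -> (forall g, fits E1 E2 y g (f g)) ->
  SFT E1 E2 (fun h => if U h && (parity h == b) then f h else y h).
Proof.
move=> Xy yf u; rewrite parity_e1 parity_e2.
have /and4P[a1 a2 a3 a4] := yf u.
have /and4P[_ b2 _ _] := yf (u + e1); have /and4P[_ _ _ c4] := yf (u + e2).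
rewrite addrK in b2; rewrite addrK in c4.
have [yu1 yu2] := Xy u.
by case: (U u); case: (U (u + e1)); case: (U (u + e2)); case: (parity u); case: b.
Qed.

(* The neighbours of T at which y conflicts with z are first refilled, one parity
   class at a time, with symbols compatible with both y and z. *)
Lemma SFT_glue (R : realType) (A : finType) (E1 E2 : {set A * A})
    (Phi : {fmap (int * int) -> A} -> R) (Lam : specification R A) y z
    (T : pred (int * int)) :
  gibbs_specification E1 E2 Phi Lam -> q Lam < 1 ->
  SFT E1 E2 y -> SFT E1 E2 z ->
  exists w, [/\ SFT E1 E2 w, forall h, T h -> w h = z h &
    forall h, ~~ T h -> (y h = z h) \/ (forall p, p \in nbrs h -> T p -> y p = z p) ->
      w h = y h].
Proof.
move=> hLam hq Xy Xz.
have fill x : SFT E1 E2 x -> exists f, forall g, fits E1 E2 x g (f g) && fits E1 E2 z g (f g).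
  move=> Xx; have [f hf] := boolp.choice (fun g => common_fill g hLam hq Xx Xz).
  by exists f.
(* Only the sites of [T] where the two points differ need overwriting. [U] collects the sites off
   [T] that could then conflict with [z]: next to [T'], and not already equal to [z]. *)
pose T' h := T h && (y h != z h).
pose U h := [&& ~~ T h, y h != z h & has T' (nbrs h)].
have [f hf] := fill _ Xy.
have X1 : SFT E1 E2 (fun h => if U h && (parity h == true) then f h else y h).
  by apply: refill => // g; case/andP: (hf g).
set y1 := (fun h => _) in X1.
(* The second parity class must fit the point as already modified, which requires a new choice of
   symbols. Both choices also fit [z], hence [y2U]. *)
have [f1 hf1] := fill _ X1.
have X2 : SFT E1 E2 (fun h => if U h && (parity h == false) then f1 h else y1 h).
  by apply: refill => // g; case/andP: (hf1 g).
set y2 := (fun h => _) in X2.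
have y2U h : U h -> fits E1 E2 z h (y2 h).
  rewrite /y2 /y1 => ->; case: (parity h) => /=; first by case/andP: (hf h).
  by case/andP: (hf1 h).
have y2N h : ~~ U h -> y2 h = y h by rewrite /y2 /y1 => /negbTE ->.
(* A neighbour of [T'] that is neither overwritten nor refilled is a site where [y] and [z]
   agree. *)
have adj h p : T' p -> p \in nbrs h -> ~~ T' h -> ~~ U h -> y2 h = z h.
  move=> Tp ph Th Uh; rewrite y2N //; move: Th Uh; rewrite /T' /U.
  have -> : has T' (nbrs h) by apply/hasP; exists p.
  by case: (eqVneq (y h) (z h)) => // yz; case: (T h).
exists (fun h => if T' h then z h else y2 h); split.
- move=> u.
  have n1 : u + e1 \in nbrs u by rewrite !inE eqxx.
  have n2 : u + e2 \in nbrs u by rewrite !inE eqxx ?orbT.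
  have n1' := n1; rewrite nbrs_sym in n1'; have n2' := n2; rewrite nbrs_sym in n2'.
  have [z1 z2] := Xz u; have [v1 v2] := X2 u.
  split.
    case: ifP => Tu; case: ifP => Tv //.
      have [/y2U/and4P[_ + _ _]|Uv] := boolP (U (u + e1)); first by rewrite addrK.
      by rewrite (adj _ u) ?Tv.
    have [/y2U/and4P[+ _ _ _]|Uv] := boolP (U u) => //.
    by rewrite (adj u (u + e1)) ?Tu.
  case: ifP => Tu; case: ifP => Tv //.
    have [/y2U/and4P[_ _ _ +]|Uv] := boolP (U (u + e2)); first by rewrite addrK.
    by rewrite (adj _ u) ?Tv.
  have [/y2U/and4P[_ _ + _]|Uv] := boolP (U u) => //.
  by rewrite (adj u (u + e2)) ?Tu.
- move=> h Th; rewrite /T' Th /=; case: eqVneq => //= yz.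
  by rewrite y2N // /U Th.
- move=> h Th hyp; rewrite /T' (negbTE Th) /= y2N // /U Th andTb.
  case: hyp => [->|np]; first by rewrite eqxx.
  rewrite negb_and; apply/orP; right; apply/hasPn => p pn; rewrite /T'.
  by apply/negP => /andP[Tp]; rewrite np ?eqxx.
Qed.

(** * Configurations of the strip *)

Lemma add_e1 (i j : int) : (i, j) + e1 = (i + 1, j).
Proof. by apply/eqP; rewrite xpair_eqE /= addr0 !eqxx. Qed.

Lemma add_e2 (i j : int) : (i, j) + e2 = (i, j + 1).
Proof. by apply/eqP; rewrite xpair_eqE /= addr0 !eqxx. Qed.

Lemma sub_e1 (i j : int) : (i, j) - e1 = (i - 1, j).
Proof. by apply/eqP; rewrite xpair_eqE /= subr0 !eqxx. Qed.

Lemma sub_e2 (i j : int) : (i, j) - e2 = (i, j - 1).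
Proof. by apply/eqP; rewrite xpair_eqE /= subr0 !eqxx. Qed.

(* Meaningful on the rows m - 1 to n + 1 only. *)
Definition bordered (A : finType) (m n : int) (t0 b0 : A) (z : int -> column A m n)
    (u : int * int) : A :=
  if u.2 == n + 1 then t0 else if u.2 == m - 1 then b0
  else z u.1 (inord (absz (u.2 - m))).

Definition column_at (A : finType) (m n : int) (x : int * int -> A) (i : int) :
  column A m n := [ffun k : 'I_(`|(n - m)%R|%N.+1) => x (i, m + (k : nat)%:Z)].

Definition has_borders (A : finType) (m n : int) (t0 b0 : A) (x : int * int -> A) :=
  forall i, x (i, n + 1) = t0 /\ x (i, m - 1) = b0.

Lemma bordered_column (A : finType) (m n : int) (t0 b0 : A) (z : int -> column A m n) i
    (k : 'I_(`|(n - m)%R|%N.+1)) :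
  m < n -> bordered t0 b0 z (i, m + (k : nat)%:Z) = z i k.
Proof.
move=> mn; have := ltn_ord k => kh; rewrite /bordered /= !ifF; try lia.
by congr (z i _); apply: val_inj; rewrite /= inordK; lia.
Qed.

Lemma bordered_borders (A : finType) (m n : int) (t0 b0 : A) (z : int -> column A m n) :
  m < n -> has_borders m n t0 b0 (bordered t0 b0 z).
Proof. by move=> mn i; rewrite /bordered /= eqxx ifF ?eqxx //; lia. Qed.

Lemma column_at_bordered (A : finType) (m n : int) (t0 b0 : A) (z : int -> column A m n) i :
  m < n -> column_at m n (bordered t0 b0 z) i = z i.
Proof. by move=> mn; apply/ffunP => k; rewrite ffunE bordered_column. Qed.

Lemma column_atP (A : finType) (m n : int) (x y : int * int -> A) i :
  m < n -> column_at m n x i = column_at m n y i <->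
  (forall j, m <= j <= n -> x (i, j) = y (i, j)).
Proof.
move=> mn; split=> [/ffunP h j mjn|h].
  have := h (inord (absz (j - m))); rewrite !ffunE inordK; last by lia.
  by rewrite (_ : m + _ = j) //; lia.
by apply/ffunP => k; rewrite !ffunE h //; have := ltn_ord k; lia.
Qed.

Lemma column_SFT_at (A : finType) (E1 E2 : {set A * A}) (m n : int) (t0 b0 : A) x :
  m < n -> SFT E1 E2 x -> has_borders m n t0 b0 x ->
  column_SFT E1 E2 t0 b0 (column_at m n x).
Proof.
move=> mn Xx bx i; split; last first.
  by apply/forallP => k; rewrite !ffunE; have := (Xx (i, m + (k : nat)%:Z)).1; rewrite add_e1.
apply/and3P; split.
- apply/forallP => k; have := ltn_ord k => kh; rewrite !ffunE !inordK; try lia.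
  have := (Xx (i, m + (k : nat)%:Z)).2; rewrite add_e2.
  by rewrite -addrA -[X in _ + (_ + X)]/(1%N%:Z) -PoszD addn1.
- rewrite ffunE /= addr0 -{1}(bx i).2.
  by have := (Xx (i, m - 1)).2; rewrite add_e2 subrK.
- rewrite ffunE /= -(bx i).1; have -> : m + `|(n - m)%R|%N%:Z = n by lia.
  by have := (Xx (i, n)).2; rewrite add_e2.
Qed.

(** The half-planes above and below the strip are copied from points of X having the constant rows
    [t] and [b]. The only new vertical edges, at the rows [m] and [n], are those tested by
    [column_allowed]. *)
Lemma column_SFT_extend (A : finType) (E1 E2 : {set A * A}) (m n : int) (t0 b0 : A) z :
  m < n -> const_row_admissible E1 E2 t0 -> const_row_admissible E1 E2 b0 ->
  column_SFT (m := m) (n := n) E1 E2 t0 b0 z ->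
  exists x, [/\ SFT E1 E2 x, has_borders m n t0 b0 x & column_at m n x = z].
Proof.
move=> mn [xt Xt xtE] [xb Xb xbE] Xz.
pose x u := if n + 1 <= u.2 then xt (u.1, u.2 - (n + 1)) else
  if u.2 <= m - 1 then xb (u.1, u.2 - (m - 1)) else bordered t0 b0 z u.
have xz i (j : int) (k : 'I_(`|(n - m)%R|%N.+1)) : j = m + (k : nat)%:Z -> x (i, j) = z i k.
  move=> ->; have := ltn_ord k => kh; rewrite /x /= !ifF ?bordered_column //; lia.
have xT i (j : int) : n + 1 <= j -> x (i, j) = xt (i, j - (n + 1)).
  by rewrite /x /= => ->.
have xB i (j : int) : j <= m - 1 -> x (i, j) = xb (i, j - (m - 1)).
  by move=> jm; rewrite /x /= jm ifF //; lia.
have bx : has_borders m n t0 b0 x.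
  by move=> i; rewrite xT // xB // !subrr xtE xbE.
exists x; split => //; last by apply/funext => i; apply/ffunP => k; rewrite ffunE (xz _ _ k).
move=> [i j]; rewrite add_e1 add_e2.
have [jn|jn] := lerP (n + 1) j.
  rewrite !xT; try lia.
  have [h1 h2] := Xt (i, j - (n + 1)); split; first by rewrite add_e1 in h1.
  by rewrite add_e2 in h2; rewrite (_ : j + 1 - (n + 1) = j - (n + 1) + 1) //; lia.
have [jm|jm] := lerP j (m - 1).
  rewrite ![x (_, j)]xB; try lia.
  have [h1 h2] := Xb (i, j - (m - 1)); split.
    by rewrite add_e1 in h1.
  have [jm'|jm'] := lerP (j + 1) (m - 1).
    rewrite xB // (_ : j + 1 - (m - 1) = j - (m - 1) + 1); last by lia.
    by rewrite add_e2 in h2.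
  have -> : j = m - 1 by lia.
  rewrite subrr xbE (xz i _ ord0); last by rewrite /=; lia.
  by case: (Xz i).1 => /and3P[].
have [k jk] : exists k : 'I_(`|(n - m)%R|%N.+1), j = m + (k : nat)%:Z.
  by exists (inord (absz (j - m))); rewrite inordK; lia.
rewrite (xz i j k) // (xz (i + 1) j k) //; have [/and3P[/forallP h1 h2 h3] /forallP h4] := Xz i.
split=> //; have [jn'|jn'] := lerP (n + 1) (j + 1).
  rewrite xT // (_ : j + 1 - (n + 1) = 0) ?xtE; last by lia.
  by rewrite (_ : k = ord_max) //; apply: val_inj => /=; lia.
have kh : (k < `|(n - m)%R|)%N by lia.
have := h1 (Ordinal kh); rewrite (_ : inord _ = k); last first.
  by apply: val_inj; rewrite /= inordK; lia.
by rewrite (xz i (j + 1) (inord k.+1)) // inordK; lia.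
Qed.

(** * The Gibbs weight of a box of columns *)

Definition grid_seq (i j : int) (p r : nat) : seq (int * int) :=
  [seq (i + a%:Z, j + b%:Z) | a <- iota 0 p, b <- iota 0 r].

Definition grid (i j : int) (p r : nat) : {fset (int * int)} :=
  [fset u in grid_seq i j p r]%fset.

Lemma mem_grid i j p r (u : int * int) :
  (u \in grid i j p r) = (i <= u.1 < i + p%:Z) && (j <= u.2 < j + r%:Z).
Proof.
rewrite !inE /=; apply/allpairsP/idP => [[[a b] /= []]|].
  by rewrite !mem_iota => ha hb -> /=; lia.
case: u => x y /= h; exists (absz (x - i), absz (y - j)); rewrite !mem_iota /=.
split; try lia; by congr pair; lia.
Qed.

Lemma sum_grid (R : realType) i j p r (F : int * int -> R) :
  \sum_(u <- grid i j p r) F u = \sum_(a < p) \sum_(b < r) F (i + a%:Z, j + b%:Z).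
Proof.
rewrite (perm_big (grid_seq i j p r)).
  have iE k : iota 0 k = index_iota 0 k by rewrite /index_iota subn0.
  rewrite big_allpairs_dep iE big_mkord; apply: eq_bigr => a _.
  by rewrite iE big_mkord.
apply: uniq_perm; rewrite ?fset_uniq //.
  by apply: allpairs_uniq; rewrite ?iota_uniq // => -[a b] [c d] _ _ /= [] h1 h2; congr pair; lia.
by move=> u; rewrite !inE.
Qed.

Lemma fset2_e1 (u v : int * int) : [fset u; (u + e1)%R]%fset = [fset v; (v + e1)%R]%fset -> u = v.
Proof.
case: u v => [a b] [c d]; rewrite !add_e1 => /fsetP h.
have := h (a, b); have := h (c, d); rewrite !inE !xpair_eqE !eqxx /= ?orbT /=.
by move=> h1 h2; congr pair; lia.
Qed.

Lemma fset2_e2 (u v : int * int) : [fset u; (u + e2)%R]%fset = [fset v; (v + e2)%R]%fset -> u = v.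
Proof.
case: u v => [a b] [c d]; rewrite !add_e2 => /fsetP h.
have := h (a, b); have := h (c, d); rewrite !inE !xpair_eqE !eqxx /= ?orbT /=.
by move=> h1 h2; congr pair; lia.
Qed.

Lemma fset2_e12 (u v : int * int) : [fset u; (u + e1)%R]%fset <> [fset v; (v + e2)%R]%fset.
Proof.
case: u v => [a b] [c d]; rewrite add_e1 add_e2 => /fsetP h.
have := h (a, b); have := h (a + 1, b); rewrite !inE !xpair_eqE !eqxx /= ?orbT /=.
lia.
Qed.

Lemma mem_edges (S : {fset (int * int)}) e :
  reflect (exists u v, [/\ u \in S, v \in nbrs u & e = [fset u; v]%fset]) (e \in edges S).
Proof.
apply: (iffP (imfset2P _ _ _ _ _)) => [[u uS [v vu ->]]|[u [v [uS vu ->]]]].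
  by exists u, v.
by exists u => //; exists v.
Qed.

(** Each edge is indexed by its left or lower end, which may lie one step outside the grid: hence
    the additional column and row. An empty grid has no edges although these enlarged index sets may
    be nonempty, whence [0 < p] and [0 < r]. *)
Lemma sum_edges_grid (R : realType) i j p r (F : {fset (int * int)} -> R) :
  (0 < p)%N -> (0 < r)%N ->
  \sum_(e <- edges (grid i j p r)) F e =
  \sum_(u <- grid (i - 1) j p.+1 r) F [fset u; (u + e1)%R]%fset +
  \sum_(u <- grid i (j - 1) p r.+1) F [fset u; (u + e2)%R]%fset.
Proof.
move=> p0 r0.
pose s1 := [seq [fset u; (u + e1)%R]%fset | u <- grid (i - 1) j p.+1 r].
pose s2 := [seq [fset u; (u + e2)%R]%fset | u <- grid i (j - 1) p r.+1].
rewrite (perm_big (s1 ++ s2)); first by rewrite big_cat !big_map.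
apply: uniq_perm; rewrite ?fset_uniq //.
  rewrite cat_uniq !map_inj_uniq ?fset_uniq /= ?andbT; [|exact: fset2_e2|exact: fset2_e1].
  by apply/hasPn => _ /mapP[u _ ->]; apply/mapP => -[v _ /esym /fset2_e12].
move=> e; rewrite mem_cat; apply/mem_edges/orP => [[[a b] [v [uS vu ->]]]|].
  move: uS; rewrite mem_grid /= => uS.
  move: vu; rewrite !inE => /or4P[] /eqP ->.
  - by left; apply/mapP; exists (a, b) => //; rewrite mem_grid /=; lia.
  - left; apply/mapP; exists ((a, b) - e1); last by rewrite subrK fsetUC.
    by rewrite sub_e1 mem_grid /=; lia.
  - by right; apply/mapP; exists (a, b) => //; rewrite mem_grid /=; lia.
  - right; apply/mapP; exists ((a, b) - e2); last by rewrite subrK fsetUC.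
    by rewrite sub_e2 mem_grid /=; lia.
case=> /mapP[[a b]]; rewrite mem_grid /= => uS ->.
  have [ai|ai] := boolP ((a, b) \in grid i j p r).
    by exists (a, b), ((a, b) + e1); rewrite ai !inE eqxx.
  exists ((a, b) + e1), (a, b); split; last by rewrite fsetUC.
    by move: ai; rewrite add_e1 !mem_grid /=; lia.
  by rewrite nbrs_sym !inE eqxx.
have [ai|ai] := boolP ((a, b) \in grid i j p r).
  by exists (a, b), ((a, b) + e2); rewrite ai !inE eqxx ?orbT.
exists ((a, b) + e2), (a, b); split; last by rewrite fsetUC.
  by move: ai; rewrite add_e2 !mem_grid /=; lia.
by rewrite nbrs_sym !inE eqxx ?orbT.
Qed.

Lemma SFT_shift (A : finType) (E1 E2 : {set A * A}) y v :
  SFT E1 E2 y -> SFT E1 E2 (fun u => y (u + v)).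
Proof. by move=> Xy u; rewrite ![u + _ + v]addrAC. Qed.

(** Invariance of [Phi] is available on the language only, so a point of X showing [w'] has to be
    supplied. *)
Lemma interaction_shift (R : realType) (A : finType) (E1 E2 : {set A * A})
    (Phi : {fmap (int * int) -> A} -> R) (w w' : {fmap (int * int) -> A}) v y :
  nn_interaction E1 E2 Phi -> SFT E1 E2 y ->
  cylinder w' y -> (forall u, w'.[? u + v]%fmap = w.[? u]%fmap) -> Phi w' = Phi w.
Proof.
move=> [h _] Xy w'y w'w; apply: (h _ _ v) => //.
exists (fun u => y (u + v)); first exact: SFT_shift.
by move=> u a ua; apply: w'y; rewrite w'w.
Qed.


Lemma fnd_catf_fun (A : finType) (S : {fset (int * int)}) (y : int * int -> A) u :
  u \in S \/ u \in outer_boundary S ->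
  (catf (FinMap [ffun u : S => y (val u)])
    (FinMap [ffun u : outer_boundary S => y (val u)])).[? u]%fmap = Some (y u).
Proof.
rewrite fnd_cat => uS; case: ifPn => [ub|ub].
  by rewrite (fnd_FinMap _ [` ub]%fset) ffunE.
have {}uS : u \in S by case: uS => // ub'; rewrite ub' in ub.
by rewrite (fnd_FinMap _ [` uS]%fset) ffunE.
Qed.

Lemma mem_outer_boundary (S : {fset (int * int)}) u v :
  u \in S -> v \in nbrs u -> v \in S \/ v \in outer_boundary S.
Proof.
move=> uS vu; have [vS|vS] := boolP (v \in S); first by left.
by right; apply/outer_boundaryP; split=> //; exists u.
Qed.

Lemma fnd_pair (A : finType) (a a' : A) (e u : int * int) :
  ([fmap].[0 <- a].[e <- a']%fmap).[? u]%fmap =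
  if u == e then Some a' else if u == 0 then Some a else None.
Proof. by rewrite !fnd_set not_fnd. Qed.

(** [y] need not be a point of X (it will be a bordered sequence of columns); [x] witnesses that its
    restrictions are admissible. *)
Lemma energy_grid (R : realType) (A : finType) (E1 E2 : {set A * A})
    (Phi : {fmap (int * int) -> A} -> R) (i j : int) (p r : nat) (y x : int * int -> A) :
  let S := grid i j p r in
  (0 < p)%N -> (0 < r)%N -> nn_interaction E1 E2 Phi -> SFT E1 E2 x ->
  (forall u, u \in S \/ u \in outer_boundary S -> x u = y u) ->
  energy Phi S (catf (FinMap [ffun u : S => y (val u)])
    (FinMap [ffun u : outer_boundary S => y (val u)])) =
  \sum_(u <- S) Phi_v Phi (y u)
  + (\sum_(u <- grid (i - 1) j p.+1 r) Phi_h Phi (y u) (y (u + e1))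
  + \sum_(u <- grid i (j - 1) p r.+1) Phi_vert Phi (y (u + e2)) (y u)).
Proof.
move=> S p0 r0 hPhi Xx xy; rewrite /energy; set w := catf _ _.
have wE u : u \in S \/ u \in outer_boundary S -> w.[? u]%fmap = Some (y u).
  exact: fnd_catf_fun.
have wx : cylinder w x.
  move=> u a; have [uS|uS] := pselect (u \in S \/ u \in outer_boundary S).
    by rewrite wE // => -[<-]; exact: xy.
  by rewrite not_fnd // mem_catf; apply/negP => /orP[]; tauto.
have wDx D : cylinder w.[& D]%fmap x.
  by move=> u a; rewrite fnd_restrict; case: ifP => // _; exact: wx.
have addE0 (u t : int * int) : (u + t == u) = (t == 0).
  by rewrite -[in X in _ == X](addr0 u) (inj_eq (addrI u)).
have pair u e : (u \in S \/ u \in outer_boundary S) ->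
    (u + e \in S \/ u + e \in outer_boundary S) ->
    Phi w.[& [fset u; (u + e)%R]%fset]%fmap = Phi [fmap].[0 <- y u].[e <- y (u + e)]%fmap.
  move=> uS eS; apply: (interaction_shift (v := u) hPhi Xx (wDx _)) => t.
  rewrite fnd_restrict fnd_pair !inE addrC (inj_eq (addrI u)) addE0.
  case: (eqVneq t e) => [->|te]; first by rewrite orbT wE.
  by case: (eqVneq t 0) => [->|t0] //=; rewrite addr0 wE.
congr (_ + _).
  apply: eq_big_seq => u uS; apply: (interaction_shift (v := u) hPhi Xx (wDx _)) => t.
  rewrite fnd_restrict fnd_set [in RHS]not_fnd // inE addrC addE0.
  by case: eqVneq => // ->; rewrite addr0 wE //; left.
have edge u v : v \in nbrs u -> u \in S \/ v \in S ->
    (u \in S \/ u \in outer_boundary S) /\ (v \in S \/ v \in outer_boundary S).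
  move=> vu [uS|vS]; first by split; [left|exact: mem_outer_boundary vu].
  by split; [apply: mem_outer_boundary vS _; rewrite nbrs_sym|left].
rewrite sum_edges_grid //; congr (_ + _); apply: eq_big_seq => -[a b] uS.
  have [||h1 h2] := edge (a, b) ((a, b) + e1); first by rewrite !inE eqxx.
    by move: uS; rewrite add_e1 !mem_grid /=; lia.
  exact: pair.
have [||h1 h2] := edge (a, b) ((a, b) + e2); first by rewrite !inE eqxx ?orbT.
  by move: uS; rewrite add_e2 !mem_grid /=; lia.
exact: pair.
Qed.

(** * Paths of columns and their energy *)

Lemma bordered_eq (A : finType) (m n : int) (t0 b0 : A) (z : int -> column A m n)
    (x : int * int -> A) u :
  m < n -> has_borders m n t0 b0 x -> m - 1 <= u.2 <= n + 1 ->
  (m <= u.2 <= n -> column_at m n x u.1 = z u.1) -> x u = bordered t0 b0 z u.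
Proof.
case: u => i j mn bx /= hj xz.
have bz := bordered_borders t0 b0 z mn.
have [->|j1] := eqVneq j (n + 1); first by rewrite (bx i).1 (bz i).1.
have [->|j2] := eqVneq j (m - 1); first by rewrite (bx i).2 (bz i).2.
have mjn : m <= j <= n by lia.
by move: (xz mjn); rewrite -(column_at_bordered t0 b0 z i mn) => /(column_atP _ _ _ mn) ->.
Qed.

Lemma columns_in_SFT (A : finType) (E1 E2 : {set A * A}) (m n : int) (t0 b0 : A) z i :
  column_SFT E1 E2 t0 b0 z -> z i \in columns E1 E2 m n t0 b0.
Proof. by move=> Xz; rewrite inE; apply/asboolP; exists z, i. Qed.

Lemma columnsP (A : finType) (E1 E2 : {set A * A}) (m n : int) (t0 b0 : A) c j :
  c \in columns E1 E2 m n t0 b0 ->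
  exists2 z, column_SFT E1 E2 t0 b0 z & z j = c.
Proof.
rewrite inE => /asboolP[z [i [Xz <-]]].
exists (fun k => z (k + (i - j))); last by rewrite addrC subrK.
by move=> k; rewrite addrAC.
Qed.

(** Here the deletion of columns that occur in no bi-infinite sequence matters: each end of the path
    continues to infinity along a sequence through its end column. *)
Lemma column_path_extend (A : finType) (E1 E2 : {set A * A}) (m n : int) (t0 b0 : A)
    (z : int -> column A m n) (j l : int) :
  j <= l -> (forall k, z k \in columns E1 E2 m n t0 b0) ->
  (forall k, j <= k < l -> columns_adjacent E1 (z k) (z (k + 1))) ->
  exists2 z', column_SFT E1 E2 t0 b0 z' & forall k, j <= k <= l -> z' k = z k.
Proof.
move=> jl zC zE; have [zl Xl zlj] := columnsP j (zC j); have [zr Xr zrl] := columnsP l (zC l).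
exists (fun k => if k < j then zl k else if k <= l then z k else zr k); last first.
  by move=> k /andP[jk kl]; rewrite ltNge jk kl.
move=> k; split.
  case: ifP => _; first exact: (Xl k).1.
  case: ifP => _; last exact: (Xr k).1.
  by have [z' Xz' <-] := columnsP k (zC k); exact: (Xz' k).1.
have [kj|kj] := ltP k j.
  have [kj'|kj'] := ltP (k + 1) j; first exact: (Xl k).2.
  have -> : k + 1 = j by lia.
  by rewrite jl -zlj (_ : j = k + 1); [exact: (Xl k).2|lia].
have -> : (k + 1 < j) = false by lia.
have [kl|kl] := lerP k l; last first.
  have -> : (k + 1 <= l) = false by lia.
  exact: (Xr k).2.
have [kl'|kl'] := lerP (k + 1) l; first by apply: zE; lia.
have -> : k = l by lia.
by rewrite -zrl; exact: (Xr l).2.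
Qed.

(** The part of [Phi_bar Phi t0 b0 c d] that does not involve [d]. *)
Definition vertical_energy (R : realType) (A : finType)
    (Phi : {fmap (int * int) -> A} -> R) (m n : int) (t0 b0 : A) (c : column A m n) : R :=
  \sum_k Phi_v Phi (c k)
  + Phi_vert Phi (c ord0) b0
  + \sum_(k < `|(n - m)%R|%N) Phi_vert Phi (c (inord k.+1)) (c (inord k))
  + Phi_vert Phi t0 (c ord_max).

Lemma vertical_energyE (R : realType) (A : finType)
    (Phi : {fmap (int * int) -> A} -> R) (m n : int) (t0 b0 : A)
    (z : int -> column A m n) i :
  let y := bordered t0 b0 z in
  m < n -> vertical_energy Phi t0 b0 (z i) = \sum_k Phi_v Phi (z i k) +
    \sum_(b < `|(n - m)%R|%N.+2)
      Phi_vert Phi (y ((i, m - 1 + b%:Z) + e2)) (y (i, m - 1 + b%:Z)).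
Proof.
move=> /= mn; have := bordered_column t0 b0 z i ^~ mn.
move: (bordered t0 b0 z) (bordered_borders t0 b0 z mn) => y yb yk.
have y0 : y (i, m) = z i ord0 by rewrite -yk [in RHS]addr0.
have yn : y (i, n) = z i ord_max by rewrite -yk /=; congr (y (i, _)); lia.
rewrite /vertical_energy; move: (Phi_v Phi) (Phi_vert Phi) => F G.
rewrite [X in _ = _ + X]big_ord_recl [X in _ = _ + (_ + X)]big_ord_recr /= addr0.
rewrite !add_e2 subrK y0 (yb i).2.
have -> : m - 1 + (bump 0 `|(n - m)%R|%N)%:Z = n by rewrite /bump; lia.
rewrite (yb i).1 yn -!addrA; congr (_ + (_ + (_ + _))).
apply: eq_bigr => k _; have := ltn_ord k => kh.
rewrite -!yk !inordK; try lia.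
by rewrite add_e2; congr (G (y (_, _)) (y (_, _))); rewrite /bump; lia.
Qed.

Definition box (m n j : int) (p : nat) := grid (j + 1) m p `|(n - m)%R|%N.+1.

(** The box has [p] columns, strictly between the columns [j] and [j + p + 1]. [Phi_bar] charges
    vertical energy to the left column of a transition, so the sum over [p + 1] transitions also
    counts column [j], whose vertical edges do not meet the box; this is subtracted. *)
Lemma energy_box (R : realType) (A : finType) (E1 E2 : {set A * A})
    (Phi : {fmap (int * int) -> A} -> R) (m n : int) (t0 b0 : A) (z : int -> column A m n)
    (j : int) (p : nat) (x : int * int -> A) :
  let S := box m n j p in let y := bordered t0 b0 z in
  (0 < p)%N -> m < n -> nn_interaction E1 E2 Phi -> SFT E1 E2 x ->
  (forall u, u \in S \/ u \in outer_boundary S -> x u = y u) ->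
  energy Phi S (catf (FinMap [ffun u : S => y (val u)])
    (FinMap [ffun u : outer_boundary S => y (val u)])) =
  \sum_(a < p.+1) Phi_bar Phi t0 b0 (z (j + a%:Z)) (z (j + a%:Z + 1))
  - vertical_energy Phi t0 b0 (z j).
Proof.
move=> S y p0 mn hPhi Xx xy; rewrite (energy_grid _ _ hPhi Xx) // !sum_grid addrK.
have -> : \sum_(a < p) \sum_(b < `|(n - m)%R|%N.+1) Phi_v Phi (y (j + 1 + a%:Z, m + b%:Z))
    = \sum_(a < p) \sum_b Phi_v Phi (z (j + 1 + a%:Z) b).
  by apply: eq_bigr => a _; apply: eq_bigr => b _; rewrite /y bordered_column.
have -> : \sum_(a < p.+1) \sum_(b < `|(n - m)%R|%N.+1)
      Phi_h Phi (y (j + a%:Z, m + b%:Z)) (y ((j + a%:Z, m + b%:Z) + e1))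
    = \sum_(a < p.+1) \sum_b Phi_h Phi (z (j + a%:Z) b) (z (j + a%:Z + 1) b).
  by apply: eq_bigr => a _; apply: eq_bigr => b _; rewrite add_e1 /y !bordered_column.
have -> : \sum_(a < p) \sum_(b < `|(n - m)%R|%N.+2)
    Phi_vert Phi (y ((j + 1 + a%:Z, m - 1 + b%:Z) + e2)) (y (j + 1 + a%:Z, m - 1 + b%:Z))
  = \sum_(a < p) (vertical_energy Phi t0 b0 (z (j + 1 + a%:Z)) -
       \sum_b Phi_v Phi (z (j + 1 + a%:Z) b)).
  by apply: eq_bigr => a _; rewrite vertical_energyE // [RHS]addrC addKr.
rewrite sumrB.
have -> : \sum_(a < p) vertical_energy Phi t0 b0 (z (j + 1 + a%:Z)) =
   \sum_(a < p.+1) vertical_energy Phi t0 b0 (z (j + a%:Z)) - vertical_energy Phi t0 b0 (z j).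
  rewrite big_ord_recl /= addr0 [RHS]addrAC subrr add0r; apply: eq_bigr => a _.
  by congr (vertical_energy _ _ _ (z _)); rewrite /bump; lia.
have -> : \sum_(a < p.+1) Phi_bar Phi t0 b0 (z (j + a%:Z)) (z (j + a%:Z + 1)) =
   \sum_(a < p.+1) vertical_energy Phi t0 b0 (z (j + a%:Z)) +
   \sum_(a < p.+1) \sum_b Phi_h Phi (z (j + a%:Z) b) (z (j + a%:Z + 1) b).
  by rewrite -big_split.
ring.
Qed.

(** If all transitions are allowed, the path of columns extends to a point of X with borders and the
    energy formula applies; otherwise both sides vanish. The prefactor involves the left end column
    only and cancels when paths with the same ends are compared. *)
Lemma weight_box (R : realType) (A : finType) (E1 E2 : {set A * A})
    (Phi : {fmap (int * int) -> A} -> R) (m n : int) (t0 b0 : A)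
    (f : int -> 'I_#|columns E1 E2 m n t0 b0|) (j : int) (p : nat) :
  let S := box m n j p in let z k := enum_val (f k) in let y := bordered t0 b0 z in
  (0 < p)%N -> m < n -> nn_interaction E1 E2 Phi ->
  const_row_admissible E1 E2 t0 -> const_row_admissible E1 E2 b0 ->
  gibbs_weight E1 E2 Phi [ffun u : outer_boundary S => y (val u)]
    [ffun u : S => y (val u)] =
  expR (vertical_energy Phi t0 b0 (z j)) *
  \prod_(a < p.+1) column_matrix E1 E2 Phi m n t0 b0 (f (j + a%:Z)) (f (j + a%:Z + 1)).
Proof.
move=> S z y p0 mn hPhi ht hb.
have Sbox u : u \in S \/ u \in outer_boundary S ->
    (j <= u.1 <= j + p%:Z + 1) && (m - 1 <= u.2 <= n + 1).
  case: u => a b [|/outer_boundaryP[_ [[c d]]]]; rewrite mem_grid /=; first lia.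
  by move=> h; rewrite !inE => /or4P[] /eqP; rewrite ?add_e1 ?add_e2 ?sub_e1 ?sub_e2 => -[-> ->]; lia.
have boxS a b : j <= a <= j + p%:Z + 1 -> m <= b <= n -> (a, b) \in S \/ (a, b) \in outer_boundary S.
  move=> ha hb'; have [aS|aS] := boolP ((a, b) \in S); first by left.
  right; apply/outer_boundaryP; split => //; move: aS; rewrite mem_grid /= => aS.
  have [->|aj] := eqVneq a j.
    by exists (j + 1, b); [rewrite mem_grid /=; lia|rewrite nbrs_sym -add_e1 !inE eqxx].
  exists (a - 1, b); [rewrite mem_grid /=; lia|].
  by rewrite nbrs_sym -sub_e1 !inE eqxx ?orbT.
have zC k : z k \in columns E1 E2 m n t0 b0 by exact: enum_valP.
have [adj|/existsNP[a /negP adj]] :=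
    pselect (forall a : 'I_p.+1, columns_adjacent E1 (z (j + a%:Z)) (z (j + a%:Z + 1))).
  have [z' Xz' z'z] : exists2 z', column_SFT E1 E2 t0 b0 z' &
      forall k, j <= k <= j + p%:Z + 1 -> z' k = z k.
    apply: column_path_extend => // [|k jk]; first by lia.
    have kp : (absz (k - j)%R < p.+1)%N by lia.
    by have := adj (Ordinal kp); rewrite /= (_ : j + _ = k) //; lia.
  have [x [Xx bx xz']] := column_SFT_extend mn ht hb Xz'.
  have xy u : u \in S \/ u \in outer_boundary S -> x u = y u.
    move=> /Sbox /andP[u1 u2]; apply: bordered_eq => // _.
    by rewrite xz' z'z.
  rewrite /gibbs_weight asboolT; last first.
    by apply/language_weight; exists x => //; split=> u; rewrite ffunE; apply: xy; have := valP u; tauto.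
  rewrite (energy_box p0 mn hPhi Xx xy) opprB expRD -sumrN expR_sum.
  congr (_ * _); apply: eq_bigr => a _.
  by rewrite [RHS]mxE /=; have := adj a; rewrite /z => ->.
(* A forbidden transition at [a] kills one factor on the right; on the left, a positive weight would
   yield a point of X with a forbidden horizontal edge. *)
have M0 : column_matrix E1 E2 Phi m n t0 b0 (f (j + a%:Z)) (f (j + a%:Z + 1)) = 0.
  by rewrite mxE /=; move: adj; rewrite /z => /negbTE ->.
rewrite (bigD1 a) //= M0 mul0r mulr0.
apply/eqP; rewrite eq_le gibbs_weight_ge0 andbT leNgt; apply/negP => /gibbs_weight_gt0.
move=> /language_weight[x Xx [xS xb]]; move: adj => /negP; apply.
have xy u : u \in S \/ u \in outer_boundary S -> x u = y u.
  by case=> uS; [rewrite (xS [` uS]%fset)|rewrite (xb [` uS]%fset)]; rewrite ffunE.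
have ap := ltn_ord a.
apply/forallP => k; have kh := ltn_ord k.
have := (Xx (j + a%:Z, m + (k : nat)%:Z)).1; rewrite add_e1 !xy; [|by apply: boxS; lia|by apply: boxS; lia].
by rewrite /y !bordered_column.
Qed.

(** * Bi-infinite sequences *)

Lemma measurable_site (V : choiceType) (A : Type) (a0 : A) (v : V) (a : A) :
  measurable [set x : config V a0 | x v = a].
Proof.
apply: sub_sigma_algebra; exists [fmap].[v <- a]%fmap => //.
apply/seteqP; split=> x /= => [h|xa u b].
  by apply: h; rewrite fnd_set eqxx.
by rewrite fnd_set; case: eqVneq => [-> [<-]|_] //; rewrite not_fnd.
Qed.

Lemma measurable_to_config d (T : measurableType d) (V : choiceType) (A : Type) (a0 : A)
    (f : T -> config V a0) :
  (forall v a, measurable [set x | f x v = a]) -> measurable_fun setT f.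
Proof.
move=> mf; apply: (@measurability _ _ T (config V a0) setT f
  (range (@cylinder V A) : set (set (config V a0)))) => [//|_ [_ [w _ <-] <-]].
rewrite setTI.
have -> : f @^-1` cylinder w = \bigcap_(v in [set` domf w])
    [set x | f x v = odflt a0 w.[? v]%fmap].
  apply/seteqP; split=> x /= h.
    by move=> v /= vw; rewrite (in_fnd vw) /=; apply: h; rewrite in_fnd.
  move=> v a va; have vw : v \in domf w.
    by apply: contraT => vw; rewrite not_fnd in va.
  by rewrite (h v) // va.
by apply: fin_bigcap_measurable => [|v _]; [exact: finite_fset|exact: mf].
Qed.

Lemma measurable_fiber d (T : measurableType d) (B : finType) (g : T -> B) (D : set B) :
  (forall b, measurable (g @^-1` [set b])) -> measurable (g @^-1` D).
Proof.
move=> mg; have -> : g @^-1` D = \bigcup_(b in D) (g @^-1` [set b]).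
  by apply/seteqP; split=> x /=; [move=> h; exists (g x)|move=> [b Db ->]].
by apply: fin_bigcup_measurable => //; exact: finite_finset.
Qed.

Lemma prob_partition d (T : measurableType d) (R : realType) (P : probability T R)
    (B : finType) (g : T -> B) (U : set T) :
  measurable U -> (forall b, measurable (g @^-1` [set b])) ->
  fine (P U) = \sum_b fine (P (U `&` g @^-1` [set b])).
Proof.
move=> mU mg; have mUg b : measurable (U `&` g @^-1` [set b]) by exact: measurableI.
rewrite sum_fine; last by move=> b _; exact: fin_num_measure.
have {1}-> : U = \bigcup_(b in [set: B]) (U `&` g @^-1` [set b]).
  by apply/seteqP; split=> x /=; [move=> Ux; exists (g x)|case=> b _ []].
rewrite measure_fin_bigcup //; [|exact: finite_finset|exact: trivIset_preimage1_in].
congr fine; rewrite (fsbig_seq _ _ (index_enum_uniq B)).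
have -> // : [set: B] = [set` index_enum B].
by apply/seteqP; split=> b //= _; rewrite mem_index_enum.
Qed.

Fixpoint path_event (B : Type) (b0 : B) (i : int) (s : seq B) : set (config int b0) :=
  if s is c :: s' then [set z : config int b0 | z i = c] `&` @path_event B b0 (i + 1) s'
  else setT.
Arguments path_event {B} b0 i s.

Lemma path_eventP (B : Type) (b0 : B) i (s : seq B) z :
  path_event b0 i s z <-> forall a, (a < size s)%N -> z (i + a%:Z) = nth b0 s a.
Proof.
elim: s i => [|c s IH] i //=; split=> [[zi /IH h] [|a] sa /=|h].
- by rewrite addr0.
- by rewrite -h // -addrA -PoszD add1n.
split; first by have := h 0%N isT; rewrite addr0.
by apply/IH => a sa; rewrite -addrA -PoszD add1n; exact: (h a.+1).
Qed.

Lemma path_event_rcons (B : Type) (b0 : B) i (s : seq B) c :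
  path_event b0 i (rcons s c) =
  path_event b0 i s `&` [set z : config int b0 | z (i + (size s)%:Z) = c].
Proof.
elim: s i => [|d s IH] i /=; first by rewrite setIT setTI addr0.
by rewrite IH setIA -addrA -PoszD add1n.
Qed.

Lemma measurable_path_event (B : Type) (b0 : B) i (s : seq B) :
  measurable (path_event b0 i s).
Proof.
elim: s i => [|c s IH] i; first exact: measurableT.
by apply: measurableI => //; exact: measurable_site.
Qed.

(* The sets of bi-infinite sequences that depend on the coordinates in [-N, N) only
   form a pi-system generating the product sigma-algebra. *)
Definition local_event (B : Type) (b0 : B) (N : nat) (U : set (config int b0)) :=
  forall z z', (forall i : int, - N%:Z <= i < N%:Z -> z i = z' i) -> U z -> U z'.

Definition window (B : finType) (b0 : B) (N : nat) (k : int) (z : config int b0) :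
  (N.*2).-tuple B := [tuple z (k - N%:Z + (a : nat)%:Z) | a < N.*2].
Arguments window {B} b0 N k z.

Lemma window_fiber (B : finType) (b0 : B) N k (t : (N.*2).-tuple B) :
  window b0 N k @^-1` [set t] = path_event b0 (k - N%:Z) t.
Proof.
apply/seteqP; split=> z /=.
  move=> <-; apply/path_eventP => a; rewrite size_tuple => aN.
  by rewrite -[a]/(nat_of_ord (Ordinal aN)) -tnth_nth tnth_mktuple.
move=> /path_eventP h; apply: eq_from_tnth => a.
by rewrite tnth_mktuple h ?size_tuple // (tnth_nth b0).
Qed.

Lemma measurable_window (B : finType) (b0 : B) N k (t : (N.*2).-tuple B) :
  measurable (window b0 N k @^-1` [set t] : set (config int b0)).
Proof. by rewrite window_fiber; exact: measurable_path_event. Qed.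

Lemma nth_window (B : finType) (b0 : B) N k (z : config int b0) (i : int) :
  - N%:Z <= i < N%:Z -> nth b0 (window b0 N k z) (absz (i + N%:Z)) = z (i + k).
Proof.
move=> iN; have : path_event b0 (k - N%:Z) (window b0 N k z) z by rewrite -window_fiber.
move=> /path_eventP <-; last by rewrite size_tuple; lia.
by congr z; lia.
Qed.

(** Shifting a local event only moves the window through which it is read; the set of accepted
    window contents is the same for all [k]. *)
Lemma local_event_window (B : finType) (b0 : B) N (U : set (config int b0)) k :
  local_event N U ->
  [set z | U (fun i => z (i + k))] =
  window b0 N k @^-1` [set t | U (fun i => nth b0 t (absz (i + N%:Z)))].
Proof.
by move=> lU; apply/seteqP; split=> z; apply: lU => i iN; rewrite nth_window.
Qed.

(** The law of the shifted sequence is compared with [nu] on local events, which suffices by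
    uniqueness of measures on a pi-system. *)
Lemma translation_invariant_of_paths (R : realType) (B : finType) (b0 : B)
    (nu : probability (config int b0) R) :
  (forall i j s, fine (nu (path_event b0 i s)) = fine (nu (path_event b0 j s))) ->
  translation_invariant nu.
Proof.
move=> inv k.
pose f (z : config int b0) : config int b0 := fun i => z (i + k).
have mf : measurable_fun setT f by apply: measurable_to_config => v a; exact: measurable_site.
have mshift (U : set (config int b0)) : measurable U ->
    measurable [set z : config int b0 | U (fun i => z (i + k))].
  by move=> mU; have := mf measurableT U mU; rewrite setTI.
pose nu' := distribution nu (mfun_Sub (mem_set mf)).
pose G := [set U : set (config int b0) | exists N, local_event N U].
have GM : G `<=` measurable.
  move=> U [N lU]; have := local_event_window 0 lU.
  have -> : [set z : config int b0 | U (fun i => z (i + 0))] = U.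
    apply/seteqP; split=> z /=; apply: lU => i _; by rewrite addr0.
  by move=> ->; apply: measurable_fiber => t; exact: measurable_window.
move=> U mU; apply: (@g_sigma_algebra_measure_unique _ R _ G GM (fun=> setT) _ _ nu' nu).
- by move=> _; exists 0%N.
- by apply: bigcup_const; exists 0%N.
- move=> V W [N lV] [M lW]; exists (maxn N M) => z z' h [Vz Wz]; split.
    by apply: lV Vz => i iN; apply: h; lia.
  by apply: lW Wz => i iN; apply: h; lia.
- move=> V GV; have mV := GM _ GV; case: GV => N lV.
  rewrite -[LHS]fineK ?fin_num_measure // -[RHS]fineK ?fin_num_measure //; congr EFin.
  have mV' := mshift _ mV.
  suff: fine (nu [set z : config int b0 | V (fun i => z (i + k))]) = fine (nu V) by [].
  rewrite (prob_partition nu mV' (@measurable_window _ _ N k)).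
  rewrite (prob_partition nu mV (@measurable_window _ _ N 0)).
  apply: eq_bigr => t _.
  rewrite (local_event_window k lV).
  have {2}-> : V = [set z | V (fun i => z (i + 0))].
    by apply/seteqP; split=> z /=; apply: lV => i _; rewrite addr0.
  rewrite (local_event_window 0 lV) -!preimage_setI.
  (* Once the window content [t] is fixed, the local event is either certain or impossible, and what
     remains is a path event. *)
  have [Vt|Vt] := pselect (V (fun i => nth b0 t (absz (i + N%:Z)))).
    rewrite setIC setIidl; last by move=> _ ->.
    by rewrite !window_fiber (inv _ (0 - N%:Z)).
  have -> : [set t' : (N.*2).-tuple B | V (fun i => nth b0 t' (absz (i + N%:Z)))]
      `&` [set t] = set0; last by rewrite !preimage_set0.
  by apply/seteqP; split=> // t' [/= + tt']; rewrite tt'.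
- by move=> _; rewrite ltey_eq fin_num_measure.
- apply: sub_sigma_algebra2 mU => _ [w _ <-].
  have [N hN] : exists N : nat, forall v, v \in domf w -> (absz v < N)%N.
    exists (\max_(v <- domf w) absz v).+1 => v vw; rewrite ltnS.
    exact: (leq_bigmax_seq (F := absz)).
  exists N => z z' zz' h v a va; rewrite -(h v a va); apply/esym/zz'.
  have vw : v \in domf w by apply: contraT => vw; rewrite not_fnd in va.
  by have := hN v vw; lia.
Qed.

Lemma chain_of_bridges (R : realType) (B : finType) (b0 : B) (C : {set B})
    (P : 'M[R]_#|C|) (nu : probability (config int b0) R) :
  let ev i (s : seq 'I_#|C|) := path_event b0 i [seq enum_val c | c <- s] in
  stochastic P -> (forall i j, 0 < (P ^+ 2) i j) ->
  (forall i b, (0 < nu [set z | z i = b])%E -> b \in C) ->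
  (forall i c s s', size s = size s' -> last c s = last c s' ->
     fine (nu (ev i (c :: s))) * path_weight P c s' =
     fine (nu (ev i (c :: s'))) * path_weight P c s) ->
  translation_invariant nu /\ markov_chain P nu.
Proof.
move=> ev sP P2 nuC br.
have mev i s : measurable (path_event b0 i s) by exact: measurable_path_event.
have msite i b : measurable [set z : config int b0 | z i = b] by exact: measurable_site.
have null i b : b \notin C -> nu [set z : config int b0 | z i = b] = 0%E.
  move=> bC; apply/eqP; rewrite eq_le measure_ge0 andbT leNgt.
  by apply/negP => /nuC; exact/negP.
have sub0 (U V : set (config int b0)) : measurable U -> measurable V -> U `<=` V ->
    nu V = 0%E -> nu U = 0%E.
  move=> mU mV UV V0; apply/eqP; rewrite eq_le measure_ge0 andbT -V0.
  by apply: le_measure; rewrite ?inE.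
(* States outside [C] are null, so a partition by the state at one position involves [C] only; this
   gives both consistency relations required by [markov_of_bridges]. *)
have part (U : set (config int b0)) i : measurable U ->
    fine (nu U) = \sum_(c < #|C|) fine (nu (U `&` [set z | z i = enum_val c])).
  move=> mU; rewrite (prob_partition nu (g := fun z : config int b0 => z i) mU) //.
  rewrite (bigID (mem C)) /= [X in _ + X]big1 ?addr0.
    by rewrite big_enum_val.
  move=> b bC; rewrite (sub0 _ [set z : config int b0 | z i = b]) ?null //.
    by apply: measurableI => //; exact: msite.
  by move=> b; exact: msite.
have [|||||g pg] := markov_of_bridges (p := fun i s => fine (nu (ev i s))) sP P2.
- by move=> i s; rewrite fine_ge0.
- by move=> i; rewrite /ev /= probability_setT.
- move=> i s; rewrite /ev (part _ i (mev _ _)); apply: eq_bigr => c _.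
  by rewrite /= setIC.
- move=> i s; rewrite /ev (part _ (i + (size s)%:Z) (mev _ _)); apply: eq_bigr => c _.
  by rewrite map_rcons path_event_rcons size_map.
- exact: br.
have pathnull i s : ~~ all (mem C) s -> nu (path_event b0 i s) = 0%E.
  elim: s i => //= b s IH i; rewrite negb_and => /orP[bC|sC].
    by apply: (sub0 _ _ _ _ _ (null i b bC)) => [||z []//]; [exact: (mev i (b :: s))|exact: msite].
  by apply: (sub0 _ _ _ _ _ (IH (i + 1) sC)) => [||z []//]; [exact: (mev i (b :: s))|exact: mev].
have inv i j s : fine (nu (path_event b0 i s)) = fine (nu (path_event b0 j s)).
  have [sC|sC] := boolP (all (mem C) s); last by rewrite !pathnull.
  have [t ->] : exists t : seq 'I_#|C|, s = [seq enum_val c | c <- t].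
    elim: s sC => [|b s IH] /=; first by exists [::].
    case/andP=> bC /IH[t ->]; exists (enum_rank_in bC b :: t).
    by rewrite /= enum_rankK_in.
  case: t => [//|c t]; have := pg i c t; have := pg j c t; rewrite /ev => -> ->.
  by [].
split; first exact: translation_invariant_of_paths.
split=> //.
- have mC i : measurable [set z : config int b0 | z i \in C].
    apply: (measurable_fiber (g := fun z : config int b0 => z i) [set b | b \in C]).
    exact: msite.
  have C1 i : nu (~` [set z : config int b0 | z i \in C]) = 0%E.
    have mCi := measurableC (mC i).
    rewrite -[LHS]fineK ?fin_num_measure // (part _ i) // big1 // => c _.
    rewrite [X in nu X](_ : _ = set0) ?measure0 //.
    by apply/seteqP; split=> // z [/= + zc]; rewrite zc enum_valP.
  have mall : measurable [set z : config int b0 | forall i, z i \in C].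
    have -> : [set z : config int b0 | forall i, z i \in C] =
      \bigcap_(n in [set: nat]) ([set z | z n%:Z \in C] `&` [set z | z (- n%:Z) \in C]).
      apply/seteqP; split=> z /= h; first by move=> n _; split; exact: h.
      by move=> [n|n]; [exact: (h n I).1|rewrite NegzE; exact: (h n.+1 I).2].
    by apply: bigcap_measurable => // n _; exact: measurableI.
  rewrite -[X in nu X]setCK probability_setC; last exact: measurableC.
  rewrite (_ : nu (~` _) = 0%E) ?sube0 //.
  apply/(measure_negligible (measurableC mall)).
  have : nu.-negligible (\bigcup_n (~` [set z : config int b0 | z n%:Z \in C] `|`
      ~` [set z | z (- n%:Z) \in C])).
    apply: negligible_bigcup => n; apply: negligibleU.
      by apply/negligibleP; [exact: measurableC|exact: C1].
    by apply/negligibleP; [exact: measurableC|exact: C1].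
  apply: negligibleS => z /= nz; have [i iC] : exists i, z i \notin C.
    by apply: contrapT => /forallNP h; apply: nz => i; have /negP := h i; rewrite negbK.
  case: i iC => [n|n] iC; first by exists n => //; left; exact/negP.
  by exists n.+1 => //; right; rewrite /= -NegzE; exact/negP.
- move=> i k w s past past0.
  (* [w] runs backwards in time from the present state [w ord0] at position [i]; [t] lists the same
     states forwards from position [i - k]. *)
  pose t := [seq w (rev_ord j) | j <- enum 'I_k.+1].
  have sizet : size t = k.+1 by rewrite size_map size_enum_ord.
  have tE a (ak : (a < k.+1)%N) : nth (w ord0) t a = w (rev_ord (Ordinal ak)).
    rewrite (nth_map (Ordinal ak)) ?size_enum_ord //; congr (w (rev_ord _)).
    exact: (nth_ord_enum (Ordinal ak) (Ordinal ak)).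
  have pastE : past = ev (i - k%:Z) t.
    apply/seteqP; split=> z; rewrite /past /ev /=.
      move=> h; apply/path_eventP => a; rewrite size_map sizet => ak.
      rewrite (nth_map (w ord0)) ?sizet // (tE a ak) -h /=.
      by congr z; lia.
    move=> /path_eventP h j; have := ltn_ord j => jk.
    have jk' : (k - j < k.+1)%N by lia.
    have := h (k - j)%N; rewrite size_map sizet => /(_ jk').
    rewrite (nth_map (w ord0)) ?sizet // (tE _ jk') => hz.
    have -> : i - (j : nat)%:Z = i - k%:Z + (k - j)%N%:Z by lia.
    by rewrite hz; congr (enum_val (w _)); apply: val_inj => /=; lia.
  have jointE : [set z : config int b0 | z (i + 1) = enum_val s] `&` past =
      ev (i - k%:Z) (rcons t s).
    rewrite pastE setIC /ev map_rcons path_event_rcons size_map sizet.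
    by have -> : i + 1 = i - k%:Z + k.+1%:Z by lia.
  rewrite /cond_prob jointE pastE.
  have tlast : last (w ord0) t = w ord0.
  by rewrite -nth_last sizet (tE k (ltnSn k)); congr w; apply: val_inj => /=; lia.
  have : 0 < fine (nu (ev (i - k%:Z) t)).
    apply: fine_gt0; rewrite -pastE past0 /= ltey_eq fin_num_measure // pastE; exact: mev.
  move: tlast sizet; case: t {tE pastE jointE} => [//|c t] /= tl _.
  have := pg (i - k%:Z) c t; have := pg (i - k%:Z) c (rcons t s).
  rewrite -rcons_cons => -> ->; rewrite path_weight_rcons tl mulrA => p0.
  by rewrite mulrAC divff ?mul1r // gt_eqF.
Qed.

(** * The induced Gibbs state *)

(** Patterns are restrictions of functions on the whole plane, so that one [y] provides the inner
    pattern, the boundary pattern and the border rows. Sites of [S] outside the strip impose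
    nothing. *)
Definition agree (m n : int) (A : finType) (t0 : A) (S : {fset (int * int)})
    (y : int * int -> A) : set (config (strip m n) t0) :=
  [set x | forall v : strip m n, val v \in S -> x v = y (val v)].
Arguments agree m n {A} t0 S y.

Lemma agree_cylinder m n (A : finType) (t0 : A) (S : {fset (int * int)}) y :
  strip_cylinder (FinMap [ffun u : S => y (val u)]) = agree m n t0 S y.
Proof.
apply/seteqP; split=> x /= h v.
  by move=> vS; apply: h; rewrite (fnd_FinMap _ [` vS]%fset) ffunE.
move=> a; have [vS|vS] := boolP (val v \in S); last by rewrite fnd_FinMapN.
by rewrite (fnd_FinMap _ [` vS]%fset) ffunE => -[<-]; exact: h.
Qed.

Lemma measurable_agree m n (A : finType) (t0 : A) (S : {fset (int * int)}) y : measurable (agree m n t0 S y).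
Proof.
have -> : agree m n t0 S y = \bigcap_(u in [set` S])
    [set x : config (strip m n) t0 | forall v : strip m n, val v = u -> x v = y u].
  apply/seteqP; split=> x /= h; first by move=> u uS v vu; rewrite -vu in uS *; exact: h.
  by move=> v vS; exact: h vS _ erefl.
apply: fin_bigcap_measurable => [|u _]; first exact: finite_fset.
have [uS|uS] := boolP (m <= u.2 <= n).
  have -> : [set x : config (strip m n) t0 | forall v : strip m n, val v = u -> x v = y u] =
      [set x | x (Sub u uS : strip m n) = y u].
    apply/seteqP; split=> x /= h; first by apply: h; rewrite SubK.
    by move=> v vu; rewrite -h; congr x; apply: val_inj; rewrite SubK.
  exact: measurable_site.
have -> : [set x : config (strip m n) t0 | forall v : strip m n, val v = u -> x v = y u] = setT.
  by apply/seteqP; split=> x // _ v vu; have := valP v; rewrite /= in vu *; rewrite vu (negbTE uS).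
exact: measurableT.
Qed.

Lemma agree_eq m n (A : finType) (t0 : A) (S : {fset (int * int)}) y y' :
  (forall u, u \in S -> y u = y' u) -> agree m n t0 S y = agree m n t0 S y'.
Proof. by move=> h; apply/seteqP; split=> x /= xy v vS; rewrite xy // h. Qed.

Lemma strip_boundaryP m n (S : {fset (int * int)}) u :
  (u \in strip_boundary m n S) = (u \in outer_boundary S) && (m <= u.2 <= n).
Proof. by rewrite !inE. Qed.

Lemma outer_boundary_strip m n (S : {fset (int * int)}) u :
  (forall u, u \in S -> m <= u.2 <= n) -> u \in outer_boundary S ->
  [|| u \in strip_boundary m n S, (u.2 == n + 1) && (u - e2 \in S)
    | (u.2 == m - 1) && (u + e2 \in S)].
Proof.
move=> Smn ub; rewrite strip_boundaryP ub /=.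
have [uS|uS] := boolP (m <= u.2 <= n) => //=.
case/outer_boundaryP: ub uS => _ [v vS]; case: u => a b.
move=> + uS; rewrite nbrs_sym !inE => /or4P[] /eqP vE; have := Smn v vS; move: uS vS.
- by rewrite vE add_e1 /=; lia.
- by rewrite vE sub_e1 /=; lia.
- by rewrite -vE vE add_e2 /= => ? -> ?; apply/orP; right; rewrite andbT; lia.
- by rewrite -vE vE sub_e2 /= => ? -> ?; apply/orP; left; rewrite andbT; lia.
Qed.

Lemma supplement_restrict m n (A : finType) (t0 b0 : A) (S : {fset (int * int)}) y :
  m < n -> (forall u, u \in S -> m <= u.2 <= n) -> has_borders m n t0 b0 y ->
  supplement t0 b0 [ffun u : strip_boundary m n S => y (val u)] =
  [ffun u : outer_boundary S => y (val u)].
Proof.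
move=> mn Smn by_; apply/ffunP => u; rewrite !ffunE.
have /or3P[ub|/andP[/eqP u2 _]|/andP[/eqP u2 _]] := outer_boundary_strip Smn (valP u).
- by rewrite (fnd_FinMap _ [` ub]%fset) ffunE.
- rewrite fnd_FinMapN ?strip_boundaryP ?u2; last by rewrite negb_and; apply/orP; right; lia.
  by rewrite eqxx -(by_ (val u).1).1 -u2 -surjective_pairing.
- rewrite fnd_FinMapN ?strip_boundaryP ?u2; last by rewrite negb_and; apply/orP; right; lia.
  by rewrite ifF -?(by_ (val u).1).2 -?u2 -?surjective_pairing //; lia.
Qed.

(** The finitely many patterns on the strip boundary partition the event, so one of them meets it
    with positive probability; [y'] is that pattern with [t] and [b] added. *)
Lemma exists_boundary (R : realType) m n (A : finType) (t0 b0 : A)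
    (mu : probability (config (strip m n) t0) R) (S : {fset (int * int)}) y :
  m < n -> (0 < mu (agree m n t0 S y))%E ->
  exists2 y', has_borders m n t0 b0 y' &
    (0 < mu (agree m n t0 S y `&` agree m n t0 (strip_boundary m n S) y'))%E.
Proof.
move=> mn Sy0; set D := strip_boundary m n S.
pose g (x : config (strip m n) t0) : {ffun D -> A} :=
  [ffun u => odflt t0 (omap x (insub (val u)))].
pose ext (d : {ffun D -> A}) u := if u.2 == n + 1 then t0 else if u.2 == m - 1 then b0
  else odflt t0 (FinMap d).[? u]%fmap.
have gE d : g @^-1` [set d] = agree m n t0 D (ext d).
  have DP u : u \in D -> m <= u.2 <= n by rewrite strip_boundaryP => /andP[].
  have extE (u : D) : ext d (val u) = d u.
    by have := DP _ (valP u); rewrite /ext fnd_FinMap /= => h; rewrite !ifF //; lia.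
  apply/seteqP; split=> x => [gx v vD|xd].
    have -> : ext d (val v) = d [` vD]%fset by rewrite -extE.
    have <- : g x = d by [].
    by rewrite ffunE [val [` vD]%fset]/(val v) valK.
  apply/ffunP => u; rewrite ffunE.
  have uD := DP _ (valP u); rewrite insubT /= -extE.
  exact: (xd (Sub (val u) uD) (valP u)).
have mD y' : measurable (agree m n t0 D y') by exact: measurable_agree.
have mS : measurable (agree m n t0 S y) by exact: measurable_agree.
have [d d0] : exists d, (0 < mu (agree m n t0 S y `&` g @^-1` [set d]))%E.
  apply: contrapT => /forallNP nd; move: Sy0.
  rewrite -[X in (_ < X)%E]fineK ?fin_num_measure //.
  rewrite (prob_partition mu (g := g) mS) => [|d]; last by rewrite gE.
  rewrite big1 ?ltxx // => d _.
  have /negP := nd d; rewrite -leNgt => h.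
  have -> : mu (agree m n t0 S y `&` g @^-1` [set d]) = 0%E; last by [].
  by apply/eqP; rewrite eq_le h measure_ge0.
exists (ext d); last by rewrite -gE.
by move=> i; rewrite /ext /= !eqxx ifF //; lia.
Qed.

Lemma conditional_specification (R : realType) m n (A : finType) (t0 b0 : A) (Lam : specification R A)
    (mu : probability (config (strip m n) t0) R) (S : {fset (int * int)}) y y' :
  m < n -> induced_gibbs_state Lam t0 b0 mu -> has_borders m n t0 b0 y' ->
  (forall u, u \in S -> m <= u.2 <= n) ->
  (0 < mu (agree m n t0 (strip_boundary m n S) y'))%E ->
  fine (mu (agree m n t0 S y `&` agree m n t0 (strip_boundary m n S) y')) =
  fine (mu (agree m n t0 (strip_boundary m n S) y')) *
  Lam S [ffun u => y' (val u)] [ffun u => y (val u)].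
Proof.
move=> mn [_ hmu] by' Smn pos.
have := hmu S [ffun u => y' (val u)] Smn; rewrite (agree_cylinder m n t0) => /(_ pos [ffun u => y (val u)]).
rewrite (agree_cylinder m n t0) supplement_restrict // => <-.
rewrite /cond_prob mulrC mulfVK // gt_eqF // fine_gt0 // pos /=.
by rewrite ltey_eq fin_num_measure //; exact: measurable_agree.
Qed.

Lemma agree_setI_le (R : realType) m n (A : finType) (t0 : A)
    (mu : probability (config (strip m n) t0) R) (S T : {fset (int * int)}) y y' :
  (mu (agree m n t0 S y `&` agree m n t0 T y') <= mu (agree m n t0 T y'))%E.
Proof.
apply: le_measure; rewrite ?inE //; last exact: measurable_agree.
by apply: measurableI; exact: measurable_agree.
Qed.

Lemma positive_spec (R : realType) m n (A : finType) (t0 b0 : A) (Lam : specification R A)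
    (mu : probability (config (strip m n) t0) R) (S : {fset (int * int)}) y :
  m < n -> induced_gibbs_state Lam t0 b0 mu -> (forall u, u \in S -> m <= u.2 <= n) ->
  (0 < mu (agree m n t0 S y))%E ->
  exists y', [/\ has_borders m n t0 b0 y',
    (0 < mu (agree m n t0 (strip_boundary m n S) y'))%E &
    0 < Lam S [ffun u => y' (val u)] [ffun u => y (val u)]].
Proof.
move=> mn hmu Smn /(exists_boundary b0 mn)[y' by' pos]; exists y'.
have pos' := lt_le_trans pos (agree_setI_le mu S (strip_boundary m n S) y y').
split=> //; have := conditional_specification y mn hmu by' Smn pos'.
have : 0 < fine (mu (agree m n t0 S y `&` agree m n t0 (strip_boundary m n S) y')).
  apply: fine_gt0; rewrite pos ltey_eq fin_num_measure //.
  by apply: measurableI; exact: measurable_agree.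
move=> h e; rewrite e in h; rewrite -(pmulr_rgt0 _ (x := fine (mu (agree m n t0 (strip_boundary m n S) y')))) //.
apply: fine_gt0; rewrite pos' ltey_eq fin_num_measure //; exact: measurable_agree.
Qed.

(** Whatever the boundary condition, [Lam] is the Gibbs law of some admissible one, so it charges
    only patterns of X. This says nothing yet about the rows [t] and [b]. *)
Lemma positive_language (R : realType) m n (A : finType) (E1 E2 : {set A * A})
    (Phi : {fmap (int * int) -> A} -> R) (t0 b0 : A) (Lam : specification R A)
    (mu : probability (config (strip m n) t0) R) (S : {fset (int * int)}) y :
  m < n -> gibbs_specification E1 E2 Phi Lam ->
  induced_gibbs_state Lam t0 b0 mu -> (forall u, u \in S -> m <= u.2 <= n) ->
  (0 < mu (agree m n t0 S y))%E ->
  exists2 x, SFT E1 E2 x & forall u, u \in S -> x u = y u.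
Proof.
move=> mn hLam hmu Smn /(positive_spec mn hmu Smn)[y' [_ _]].
have [d' ld' ->] := specification_gibbs [ffun u : outer_boundary S => y' (val u)] hLam.
rewrite /gibbs pmulr_lgt0 ?invr_gt0 ?gibbs_partition_gt0 //.
move=> /gibbs_weight_gt0/language_weight[x Xx [xS _]]; exists x => // u uS.
by rewrite (xS [` uS]%fset) ffunE.
Qed.

(** A point with row [n + 1] equal to [t] is overwritten on row [m - 1]. Elsewhere only the rows
    [m - 2] and [m] may change, and [m < n] keeps [n + 1] clear of them. *)
Lemma exists_borders (R : realType) m n (A : finType) (E1 E2 : {set A * A})
    (Phi : {fmap (int * int) -> A} -> R) (t0 b0 : A) (Lam : specification R A) :
  m < n -> gibbs_specification E1 E2 Phi Lam -> q Lam < 1 ->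
  const_row_admissible E1 E2 t0 -> const_row_admissible E1 E2 b0 ->
  exists2 z, SFT E1 E2 z & has_borders m n t0 b0 z.
Proof.
move=> mn hLam hq [xt Xt xtE] [xb Xb xbE].
have [w [Xw wT wN]] := SFT_glue (fun u => u.2 == m - 1) hLam hq
  (SFT_shift (0, - (n + 1)) Xt) (SFT_shift (0, - (m - 1)) Xb).
have rowE (x : int * int -> A) i (j : int) : x ((i, j) + (0, - j)) = x (i, 0).
  by congr x; apply/eqP; rewrite xpair_eqE /= addr0 subrr !eqxx.
exists w => // i; split; last by rewrite wT //= rowE.
rewrite wN /=; [by rewrite rowE|lia|].
right=> -[a b]; rewrite !inE => /or4P[] /eqP; rewrite ?add_e1 ?sub_e1 ?add_e2 ?sub_e2;
by move=> [-> ->] /=; lia.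
Qed.

(** A point of X with the charged pattern on the strip boundary and a point with both border rows
    are glued along the part of the outer boundary lying outside the strip. On such boundaries [Lam]
    is then the Gibbs law itself. *)
Lemma boundary_extends (R : realType) m n (A : finType) (E1 E2 : {set A * A})
    (Phi : {fmap (int * int) -> A} -> R) (t0 b0 : A) (Lam : specification R A)
    (mu : probability (config (strip m n) t0) R) (S : {fset (int * int)}) y :
  m < n -> gibbs_specification E1 E2 Phi Lam -> q Lam < 1 ->
  const_row_admissible E1 E2 t0 -> const_row_admissible E1 E2 b0 ->
  induced_gibbs_state Lam t0 b0 mu -> (forall u, u \in S -> m <= u.2 <= n) ->
  has_borders m n t0 b0 y ->
  (0 < mu (agree m n t0 (strip_boundary m n S) y))%E ->
  language E1 E2 (FinMap [ffun u : outer_boundary S => y (val u)]).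
Proof.
move=> mn hLam hq ht hb hmu Smn by_ pos.
have [|x Xx xy] := positive_language mn hLam hmu _ pos.
  by move=> u; rewrite strip_boundaryP => /andP[].
have [z Xz bz] := exists_borders mn hLam hq ht hb.
pose T u := (u \in outer_boundary S) && (u \notin strip_boundary m n S).
have [w [Xw wT wN]] := SFT_glue T hLam hq Xx Xz.
apply/language_cylinder; exists w => // u; rewrite ffunE; set v := val u.
have vb : v \in outer_boundary S := valP u.
have [vs|vs] := boolP (v \in strip_boundary m n S).
  (* A site of [T] lies directly above or below a site of [S]. Since [v] is not in [S], it has no
     neighbour in [T] and keeps its symbol. *)
  rewrite wN ?xy // /T ?vb ?vs //; right=> p pv /andP[pb ps].
  have := outer_boundary_strip Smn pb; rewrite (negbTE ps) /=.
  case/outer_boundaryP: vb => vS _; move: vs; rewrite strip_boundaryP => /andP[_ vmn].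
  move: pv vS vmn; case: (v) => a b; rewrite !inE => /or4P[] /eqP -> vS vmn.
  - by rewrite add_e1 /=; move: vmn => /=; lia.
  - by rewrite sub_e1 /=; move: vmn => /=; lia.
  - rewrite addrK (negbTE vS) andbF add_e2 /=; move: vmn => /=; lia.
  - rewrite subrK (negbTE vS) andbF sub_e2 /=; move: vmn => /=; lia.
rewrite wT /T ?vb ?vs //.
have := outer_boundary_strip Smn vb; rewrite (negbTE vs) /=; case: (v) => a b /=.
by case/orP => /andP[/eqP -> _]; rewrite ?(by_ a).1 ?(by_ a).2 ?(bz a).1 ?(bz a).2.
Qed.

Lemma positive_extends (R : realType) m n (A : finType) (E1 E2 : {set A * A})
    (Phi : {fmap (int * int) -> A} -> R) (t0 b0 : A) (Lam : specification R A)
    (mu : probability (config (strip m n) t0) R) (S : {fset (int * int)}) y :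
  m < n -> gibbs_specification E1 E2 Phi Lam -> q Lam < 1 ->
  const_row_admissible E1 E2 t0 -> const_row_admissible E1 E2 b0 ->
  induced_gibbs_state Lam t0 b0 mu -> (forall u, u \in S -> m <= u.2 <= n) ->
  (0 < mu (agree m n t0 S y))%E ->
  exists x, [/\ SFT E1 E2 x, has_borders m n t0 b0 x & forall u, u \in S -> x u = y u].
Proof.
move=> mn hLam hq ht hb hmu Smn pos.
have [y' [by' pos']] := positive_spec mn hmu Smn pos.
have ly := boundary_extends mn hLam hq ht hb hmu Smn by' pos'.
rewrite (hLam _ _).1 // /gibbs pmulr_lgt0 ?invr_gt0 ?gibbs_partition_gt0 //.
move=> /gibbs_weight_gt0/language_weight[x Xx [xS xb]].
have [z Xz bz] := exists_borders mn hLam hq ht hb.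
pose T (u : int * int) := (u.2 == n + 1) || (u.2 == m - 1).
have [w [Xw wT wN]] := SFT_glue T hLam hq Xx Xz.
exists w; split=> // [i|u uS].
  by rewrite !wT /T /= ?eqxx ?orbT //; exact: bz.
have umn := Smn u uS.
rewrite wN; first by rewrite (xS [` uS]%fset) ffunE.
  by rewrite /T; move: umn; case: (u) => a b /=; lia.
(* A border site next to [u] belongs to the outer boundary of [S], where [x] already carries [t] or
   [b]; overwriting the border rows therefore leaves [u] unchanged. *)
right=> p pu Tp; have pb : p \in outer_boundary S.
  apply/outer_boundaryP; split; last by exists u.
  by apply/negP => /Smn; move: Tp; rewrite /T; case: (p) => a b /=; lia.
rewrite (xb [` pb]%fset) ffunE /=; move: Tp; rewrite /T; case: (p) => a b /=.
by case/orP => /eqP ->; rewrite ?(by' a).1 ?(by' a).2 ?(bz a).1 ?(bz a).2.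
Qed.

Lemma gibbs_cond (R : realType) m n (A : finType) (E1 E2 : {set A * A})
    (Phi : {fmap (int * int) -> A} -> R) (t0 b0 : A) (Lam : specification R A)
    (mu : probability (config (strip m n) t0) R) (S : {fset (int * int)}) y :
  m < n -> gibbs_specification E1 E2 Phi Lam -> q Lam < 1 ->
  const_row_admissible E1 E2 t0 -> const_row_admissible E1 E2 b0 ->
  induced_gibbs_state Lam t0 b0 mu -> (forall u, u \in S -> m <= u.2 <= n) ->
  has_borders m n t0 b0 y ->
  (0 < mu (agree m n t0 (strip_boundary m n S) y))%E ->
  fine (mu (agree m n t0 S y `&` agree m n t0 (strip_boundary m n S) y)) =
  fine (mu (agree m n t0 (strip_boundary m n S) y)) *
  gibbs E1 E2 Phi [ffun u : outer_boundary S => y (val u)] [ffun u => y (val u)].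
Proof.
move=> mn hLam hq ht hb hmu Smn by_ pos; rewrite (conditional_specification y mn hmu by_ Smn pos).
by rewrite (hLam _ _).1 //; exact: (boundary_extends mn hLam hq ht hb hmu Smn by_ pos).
Qed.

(** * Bridges of the column process *)

Lemma to_columns_path m n (A : finType) (t0 : A) (c0 : column A m n) i s
    (y : int * int -> A) :
  m < n -> (forall a, (a < size s)%N -> column_at m n y (i + a%:Z) = nth c0 s a) ->
  @to_columns A m n t0 @^-1` path_event [ffun=> t0] i s =
  agree m n t0 (grid i m (size s) `|(n - m)%R|%N.+1) y.
Proof.
move=> mn ys.
have rng (u : int * int) : m <= u.2 <= n ->
    (absz (u.2 - m)%R < `|(n - m)%R|%N.+1)%N /\ (u.1, m + (absz (u.2 - m))%:Z) = u.
  by case: u => a b /= ?; split; [lia|congr pair; lia].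
have xE (x : config (strip m n) t0) (v : strip m n) :
    to_columns x (val v).1 (inord (absz ((val v).2 - m))) = x v.
  have [v1 v2] := rng _ (valP v).
  rewrite ffunE inordK // v2.
  by rewrite valK.
have cE a : (a < size s)%N -> nth [ffun=> t0] s a = column_at m n y (i + a%:Z).
  by move=> sa; rewrite ys //; exact: set_nth_default.
apply/seteqP; split=> x /=.
  move=> /path_eventP h v; rewrite mem_grid => /andP[v1 v2].
  have sa : (absz ((val v).1 - i)%R < size s)%N by move: v1; case: (val v) => a b /=; lia.
  have ia : i + (absz ((val v).1 - i))%:Z = (val v).1.
    by move: v1; case: (val v) => a b /=; lia.
  have := h _ sa; rewrite cE // ia => /ffunP/(_ (inord (absz ((val v).2 - m)))).
  have [w1 w2] := rng _ (valP v).
  by rewrite xE => ->; rewrite ffunE inordK // w2.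
move=> h; apply/path_eventP => a sa; rewrite cE //; apply/ffunP => k.
have kh := ltn_ord k; have uS : m <= (i + a%:Z, m + (k : nat)%:Z).2 <= n by rewrite /=; lia.
rewrite !ffunE insubT /= h //.
by rewrite mem_grid /=; lia.
Qed.

Lemma measurable_to_columns m n (A : finType) (t0 : A) :
  m < n -> measurable_fun setT (@to_columns A m n t0).
Proof.
move=> mn; apply: measurable_to_config => i c.
have -> : [set x | to_columns (a0 := t0) x i = c] =
    @to_columns A m n t0 @^-1` path_event [ffun=> t0] i [:: c] by rewrite /= setIT.
rewrite (@to_columns_path m n A t0 c i [:: c] (bordered t0 t0 (fun=> c))) //.
  exact: measurable_agree.
by move=> [] // _; rewrite column_at_bordered.
Qed.

Lemma path_weight_prod (R : realType) (N : nat) (M : 'M[R]_N) c s :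
  path_weight M c s = \prod_(a < size s) M (nth c (c :: s) a) (nth c (c :: s) a.+1).
Proof.
elim: s c => [|d s IH] c /=; first by rewrite big_ord0.
rewrite big_ord_recl /= IH; congr (_ * _); apply: eq_bigr => a _.
have aS := ltn_ord a.
by congr (M _ _); apply: set_nth_default; rewrite /=; lia.
Qed.

(** A point with [c] at position 0 is overwritten at position 2 by a point with [d] there. Positions
    1 and 3 may change, but not position 0, nor the border rows, on which the two points agree. *)
Lemma columns_connected (R : realType) m n (A : finType) (E1 E2 : {set A * A})
    (Phi : {fmap (int * int) -> A} -> R) (t0 b0 : A) (Lam : specification R A) c d :
  m < n -> gibbs_specification E1 E2 Phi Lam -> q Lam < 1 ->
  const_row_admissible E1 E2 t0 -> const_row_admissible E1 E2 b0 ->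
  c \in columns E1 E2 m n t0 b0 -> d \in columns E1 E2 m n t0 b0 ->
  exists2 e, e \in columns E1 E2 m n t0 b0 &
    columns_adjacent E1 c e && columns_adjacent E1 e d.
Proof.
move=> mn hLam hq ht hb cC dC.
have [zc Xc zc0] := columnsP 0 cC; have [zd Xd zd2] := columnsP 2 dC.
have [x [Xx bx xz]] := column_SFT_extend mn ht hb Xc.
have [y [Xy by_ yz]] := column_SFT_extend mn ht hb Xd.
pose T (u : int * int) := (u.1 == 2) && (m <= u.2 <= n).
have [w [Xw wT wN]] := SFT_glue T hLam hq Xx Xy.
have bw : has_borders m n t0 b0 w.
  move=> i; rewrite !wN ?(bx i).1 ?(bx i).2 ?(by_ i).1 ?(by_ i).2 //; try by left.
    by rewrite /T /=; lia.
  by rewrite /T /=; lia.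
have w0 : column_at m n w 0 = c.
  rewrite -zc0 -xz; apply/(column_atP _ _ _ mn) => j mjn; rewrite wN //.
  right=> -[a b]; rewrite !inE => /or4P[] /eqP; rewrite ?add_e1 ?sub_e1 ?add_e2 ?sub_e2;
  by move=> [-> ->]; rewrite /T /=; lia.
have w2 : column_at m n w 2 = d.
  by rewrite -zd2 -yz; apply/(column_atP _ _ _ mn) => j mjn; rewrite wT // /T /=.
have Xcol := column_SFT_at mn Xw bw.
exists (column_at m n w 1); first exact: columns_in_SFT Xcol.
by rewrite -w0 -w2; rewrite (Xcol 0).2 (Xcol 1).2.
Qed.

Lemma column_matrix_ge0 (R : realType) m n (A : finType) (E1 E2 : {set A * A})
    (Phi : {fmap (int * int) -> A} -> R) (t0 b0 : A) i j :
  0 <= column_matrix E1 E2 Phi m n t0 b0 i j.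
Proof. by rewrite mxE /=; case: ifP => // _; exact: expR_ge0. Qed.

Lemma column_matrix_sqr_gt0 (R : realType) m n (A : finType) (E1 E2 : {set A * A})
    (Phi : {fmap (int * int) -> A} -> R) (t0 b0 : A) (Lam : specification R A) :
  m < n -> gibbs_specification E1 E2 Phi Lam -> q Lam < 1 ->
  const_row_admissible E1 E2 t0 -> const_row_admissible E1 E2 b0 ->
  forall i j, 0 < (column_matrix E1 E2 Phi m n t0 b0 ^+ 2) i j.
Proof.
move=> mn hLam hq ht hb i j; set M := column_matrix E1 E2 Phi m n t0 b0.
have [e eC /andP[ce ed]] := columns_connected mn hLam hq ht hb (enum_valP i) (enum_valP j).
rewrite expr2 mxE (bigD1 (enum_rank_in eC e)) //= ltr_pwDl //; last first.
  by rewrite sumr_ge0 // => k _; rewrite mulr_ge0 ?column_matrix_ge0.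
by apply: mulr_gt0; rewrite mxE /= enum_rankK_in // ?ce ?ed expR_gt0.
Qed.

(** The strip boundary of the box is its two end columns, which [f] and [f'] share. Both conditional
    probabilities thus have the same normalisation and the same prefactor, and their ratio is that
    of the products [W]. *)
Lemma bridge_box (R : realType) m n (A : finType) (E1 E2 : {set A * A})
    (Phi : {fmap (int * int) -> A} -> R) (t0 b0 : A) (Lam : specification R A)
    (mu : probability (config (strip m n) t0) R)
    (f f' : int -> 'I_#|columns E1 E2 m n t0 b0|) (j : int) (p : nat) :
  let M := column_matrix E1 E2 Phi m n t0 b0 in
  let W g := \prod_(a < p.+1) M (g (j + a%:Z)) (g (j + a%:Z + 1)) in
  let ev (g : int -> 'I_#|columns E1 E2 m n t0 b0|) := fine (mu (agree m n t0
    (grid j m p.+2 `|(n - m)%R|%N.+1) (bordered t0 b0 (fun k => enum_val (g k))))) in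
  m < n -> (0 < p)%N -> nn_interaction E1 E2 Phi ->
  gibbs_specification E1 E2 Phi Lam -> q Lam < 1 ->
  const_row_admissible E1 E2 t0 -> const_row_admissible E1 E2 b0 ->
  induced_gibbs_state Lam t0 b0 mu ->
  f j = f' j -> f (j + p.+1%:Z) = f' (j + p.+1%:Z) ->
  ev f * W f' = ev f' * W f.
Proof.
move=> M W ev mn p0 hPhi hLam hq ht hb hmu fj fjp.
pose y (g : int -> 'I_#|columns E1 E2 m n t0 b0|) := bordered t0 b0 (fun k => enum_val (g k)).
pose S := box m n j p; pose D := strip_boundary m n S.
have Smn u : u \in S -> m <= u.2 <= n by rewrite mem_grid; case: u => a b /=; lia.
have DP u : u \in D -> (m <= u.2 <= n) && ((u.1 == j) || (u.1 == j + p.+1%:Z)).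
  rewrite strip_boundaryP => /andP[/outer_boundaryP[uS [[c d] cd un]] umn].
  move: uS umn cd un; case: u => a b; rewrite !mem_grid => uS umn cd.
  rewrite !inE => /or4P[] /eqP; rewrite ?add_e1 ?sub_e1 ?add_e2 ?sub_e2 => -[aE bE];
  by move: uS umn cd; rewrite aE bE /=; lia.
have inD a b : m <= b <= n -> (a == j) || (a == j + p.+1%:Z) -> (a, b) \in D.
  move=> mbn aE; rewrite strip_boundaryP /= mbn andbT.
  apply/outer_boundaryP; split; first by rewrite mem_grid /=; lia.
  have [aj|aj] := eqVneq a j.
    by exists (a + 1, b); [rewrite mem_grid /=; lia|rewrite nbrs_sym -add_e1 !inE eqxx].
  exists (a - 1, b); first by rewrite mem_grid /=; lia.
  by rewrite nbrs_sym -sub_e1 !inE eqxx ?orbT.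
have evE g : ev g = fine (mu (agree m n t0 S (y g) `&` agree m n t0 D (y g))).
  congr (fine (mu _)); apply/seteqP; split=> x /=.
    move=> h; split=> v vS; apply: h; rewrite mem_grid.
      by move: vS; rewrite mem_grid; case: (val v) => a b /=; lia.
    by have := DP _ vS; case: (val v) => a b /=; lia.
  move=> [hS hD] v; rewrite mem_grid => vG.
  have [vS|vS] := boolP (val v \in S); first exact: hS.
  apply: hD; move: vG vS; rewrite mem_grid; case: (val v) => a b /= vG vS.
  by apply: inD; lia.
have yD u : u \in D -> y f u = y f' u.
  move=> /DP /andP[u2 u1]; rewrite /y /bordered; case: ifP => // _; case: ifP => // _.
  by case/orP: u1 => /eqP ->; rewrite ?fj ?fjp.
have DE : agree m n t0 D (y f) = agree m n t0 D (y f') by exact: agree_eq.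
have yout u : u \in outer_boundary S -> y f u = y f' u.
  move=> ub; have := outer_boundary_strip Smn ub; rewrite -/D => /or3P[/yD //||].
    by case/andP => /eqP u2 _; rewrite /y /bordered u2 eqxx.
  by case/andP => /eqP u2 _; rewrite /y /bordered u2 eqxx; case: ifP.
(* Conditioning is impossible when the end columns are not charged; then both path events are
   null. *)
have [D0|D0] := eqVneq (mu (agree m n t0 D (y f))) 0%E.
  have z g : mu (agree m n t0 D (y g)) = 0%E -> ev g = 0.
    move=> g0; rewrite evE.
    have -> : mu (agree m n t0 S (y g) `&` agree m n t0 D (y g)) = 0%E; last by [].
    by apply/eqP; rewrite eq_le measure_ge0 andbT -g0 agree_setI_le.
  by rewrite !z ?mul0r // -DE.
have Dpos : (0 < mu (agree m n t0 D (y f)))%E by rewrite lt_neqAle eq_sym D0 measure_ge0.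
have cond g : (0 < mu (agree m n t0 D (y g)))%E -> ev g =
    fine (mu (agree m n t0 D (y g))) *
    gibbs E1 E2 Phi [ffun u : outer_boundary S => y g (val u)] [ffun u => y g (val u)].
  move=> g0; rewrite evE.
  exact: (gibbs_cond mn hLam hq ht hb hmu Smn (bordered_borders t0 b0 _ mn)).
have scale (a a' d g g' w w' : R) :
    a = d * g -> a' = d * g' -> g * w' = g' * w -> a * w' = a' * w.
  by move=> -> -> e; rewrite -!mulrA e.
have Dpos' := Dpos; rewrite DE in Dpos'.
have ef := cond f Dpos; have ef' := cond f' Dpos'; rewrite -DE in ef'.
apply: (scale _ _ _ _ _ _ _ ef ef'); rewrite /gibbs.
have -> : [ffun u : outer_boundary S => y f' (val u)] = [ffun u : outer_boundary S => y f (val u)].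
  by apply/ffunP => u; rewrite !ffunE yout //; exact: valP.
have wt g : (forall u, u \in outer_boundary S -> y f u = y g u) -> f j = g j ->
    gibbs_weight E1 E2 Phi [ffun u : outer_boundary S => y f (val u)]
      [ffun u : S => y g (val u)] =
    expR (vertical_energy Phi t0 b0 (enum_val (f j))) * W g.
  move=> fg fgj; rewrite fgj -(weight_box g j p0 mn hPhi ht hb).
  by congr gibbs_weight; apply/ffunP => u; rewrite !ffunE fg //; exact: valP.
rewrite (wt f) // (wt f') //; ring.
Qed.

Lemma positive_column (R : realType) m n (A : finType) (E1 E2 : {set A * A})
    (Phi : {fmap (int * int) -> A} -> R) (t0 b0 : A) (Lam : specification R A)
    (mu : probability (config (strip m n) t0) R) i c :
  m < n -> gibbs_specification E1 E2 Phi Lam -> q Lam < 1 ->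
  const_row_admissible E1 E2 t0 -> const_row_admissible E1 E2 b0 ->
  induced_gibbs_state Lam t0 b0 mu ->
  (0 < mu (@to_columns A m n t0 @^-1` path_event [ffun=> t0] i [:: c]))%E ->
  c \in columns E1 E2 m n t0 b0.
Proof.
move=> mn hLam hq ht hb hmu.
have yc : column_at m n (bordered t0 b0 (fun=> c)) i = c by rewrite column_at_bordered.
rewrite (@to_columns_path m n A t0 c i [:: c] (bordered t0 b0 (fun=> c))) //; last first.
  by move=> [] // _; rewrite column_at_bordered.
case/(positive_extends mn hLam hq ht hb hmu) => [u|x [Xx bx xS]].
  by rewrite mem_grid; case: u => a b /=; lia.
have <- : column_at m n x i = c.
  rewrite -yc; apply/(column_atP _ _ _ mn) => j mjn; apply: xS.
  by rewrite mem_grid /=; lia.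
exact: columns_in_SFT (column_SFT_at mn Xx bx).
Qed.

Lemma bridge_columns (R : realType) m n (A : finType) (E1 E2 : {set A * A})
    (Phi : {fmap (int * int) -> A} -> R) (t0 b0 : A) (Lam : specification R A)
    (mu : probability (config (strip m n) t0) R) i c s s' :
  let M := column_matrix E1 E2 Phi m n t0 b0 in
  let ev (r : seq 'I_#|columns E1 E2 m n t0 b0|) :=
    fine (mu (@to_columns A m n t0 @^-1`
      path_event [ffun=> t0] i [seq enum_val d | d <- r])) in
  m < n -> nn_interaction E1 E2 Phi ->
  gibbs_specification E1 E2 Phi Lam -> q Lam < 1 ->
  const_row_admissible E1 E2 t0 -> const_row_admissible E1 E2 b0 ->
  induced_gibbs_state Lam t0 b0 mu -> size s = size s' -> last c s = last c s' ->
  ev (c :: s) * path_weight M c s' = ev (c :: s') * path_weight M c s.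
Proof.
move=> M ev mn hPhi hLam hq ht hb hmu ss' ls.
(* A path of at most one step is determined by its ends; a longer one has inner columns, as the box
   formula requires. *)
have [s1|s1] := leqP (size s) 1.
  suff -> : s = s' by [].
  by case: s s' s1 ss' ls => [|d [|? ?]] [|d' [|? ?]] //= _ _ ->.
(* The continuation of the path to all integers is arbitrary: only the positions from [i] to
   [i + size r] are read. *)
pose f r (k : int) := nth c (c :: r) (absz (k - i)).
have fE r a : f r (i + a%:Z) = nth c (c :: r) a.
  by rewrite /f (_ : absz _ = a) //; lia.
have evE r : ev (c :: r) = fine (mu (agree m n t0
    (grid i m (size r).+1 `|(n - m)%R|%N.+1) (bordered t0 b0 (fun k => enum_val (f r k))))).
  rewrite /ev (@to_columns_path m n A t0 (enum_val c) i _
    (bordered t0 b0 (fun k => enum_val (f r k)))) ?size_map // => a ar.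
  rewrite column_at_bordered // fE (nth_map c) //.
have WE r : path_weight M c r =
    \prod_(a < size r) M (f r (i + a%:Z)) (f r (i + a%:Z + 1)).
  rewrite path_weight_prod; apply: eq_bigr => a _.
  by rewrite fE (_ : i + a%:Z + 1 = i + a.+1%:Z) ?fE //; lia.
rewrite !evE !WE -ss'.
case E : (size s) s1 => [//|p] p0; rewrite E in ss'.
apply: (bridge_box mn p0 hPhi hLam hq ht hb hmu).
  by have := fE s 0%N; have := fE s' 0%N; rewrite addr0 => -> ->.
have := nth_last c (c :: s); have := nth_last c (c :: s').
by rewrite !fE /= -ss' E ls /= => -> ->.
Qed.

Theorem proposition6p3 (R : realType) (A : finType) (E1 E2 : {set A * A})
  (L : nat) (Phi : {fmap (int * int) -> A} -> R) (Lam : specification R A)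
  (m n : int) (t0 b0 : A) (mu : probability (config (strip m n) t0) R)
  (hA : (1 < #|A|)%N)
  (hX : exists x, SFT E1 E2 x)
  (hSI : strongly_irreducible E1 E2 L)
  (hPhi : nn_interaction E1 E2 Phi)
  (hLam : gibbs_specification E1 E2 Phi Lam)
  (ht : const_row_admissible E1 E2 t0)
  (hb : const_row_admissible E1 E2 b0)
  (hmn : L%:Z < n - m)
  (hq : q Lam < 1)
  (hmu : induced_gibbs_state Lam t0 b0 mu) :
  let nu := pushforward mu (@to_columns A m n t0) in
  let Pi := transition_matrix E1 E2 Phi m n t0 b0 in
  translation_invariant nu /\ markov_chain Pi nu /\ primitive Pi.
Proof.
have mn : m < n by lia.
move=> nu Pi; pose M := column_matrix E1 E2 Phi m n t0 b0.
(* A Perron vector requires a nonempty index set; any point with both borders shows a column that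
   survives deletion. *)
have C0 : (0 < #|columns E1 E2 m n t0 b0|)%N.
  have [z Xz bz] := exists_borders mn hLam hq ht hb.
  by apply/card_gt0P; exists (column_at m n z 0); apply/columns_in_SFT/column_SFT_at.
have M0 := @column_matrix_ge0 R m n A E1 E2 Phi t0 b0.
have M2 := column_matrix_sqr_gt0 mn hLam hq ht hb.
have [lam0 v0 Mv] := perron_spec C0 M0 M2.
have [sPi Pi2] := stochastic_doob M0 M2 lam0 v0 Mv.
pose X := mfun_Sub (mem_set (@measurable_to_columns m n A t0 mn)).
pose P : probability (config int ([ffun=> t0] : column A m n)) R := distribution mu X.
have [] := @chain_of_bridges R _ [ffun=> t0] _ Pi P sPi Pi2.
- move=> i c c0; apply: (positive_column mn hLam hq ht hb hmu (i := i)).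
  by rewrite /= setIT.
- move=> i c s s' ss' ls; rewrite /Pi /transition_matrix !path_weight_doob // ls ss'.
  have scale (x y z t k : R) : x * y = z * t -> x * (y * k) = z * (t * k).
    by move=> e; rewrite !mulrA e.
  exact/scale/(bridge_columns i mn hPhi hLam hq ht hb hmu ss' ls).
move=> nuT nuM; split; first exact: nuT.
by split; [exact: nuM|exists 2%N].
Qed.
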